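(* For each integer $n$ with $2\le n\le 7$, the congruence two subgroup $\Gamma^n_2$ of $\Gamma^n=PO_{n,1}\mathbb{Z}$ is a hyperbolic Coxeter group with Coxeter polytope the right-angled polytope $P^n$. That is, $P^n$ is a right-angled hyperbolic polytope, $P^n$ is a fundamental polytope for the action of $\Gamma^n_2$ on $H^n$, and $\Gamma^n_2$ is the group generated by the reflections in the sides of $P^n$.
   Context: Work in $\mathbb{R}^{n+1}$ with the Lorentzian inner product $\langle x,y\rangle=x_1y_1+\dots+x_ny_n-x_{n+1}y_{n+1}$ and the hyperboloid model $H^n=\{x\in\mathbb{R}^{n+1}:\langle x,x\rangle=-1,\ x_{n+1}>0\}$; isometries of $H^n$ are the positive Lorentzian $(n+1)\times(n+1)$ matrices (those preserving $\langle\cdot,\cdot\rangle$ and the sign of the last coordinate on time-like vectors). $\Gamma^n=PO_{n,1}\mathbb{Z}$ denotes the group of positive Lorentzian $(n+1)\times(n+1)$ matrices with integer entries, and $\Gamma^n_2$ is its subgroup of matrices congruent to the identity matrix modulo $2$. A polytope in $H^n$ is a convex polyhedron with finitely many sides and finite volume (equivalently, the convex hull of finitely many actual and ideal vertices); it is right-angled if all dihedral angles between adjacent sides are $0$ or $\pi/2$. Let $\Delta^n$ be the simplex $\Delta^n=\{x\in H^n: x_1\ge x_2\ge\dots\ge x_n\ge 0,\ x_1+x_2+x_3\le x_{n+1}\}$ for $n\ge 3$, and $\Delta^2=\{x\in H^2: x_1\ge x_2\ge 0,\ x_1+x_2\le x_3\}$ (its vertices are represented by $e_1+e_{n+1}$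 (ideal), $e_1+e_2+2e_{n+1}$, $e_1+\dots+e_k+3e_{n+1}$ for $3\le k\le n$, and $e_{n+1}$). For $n\ge3$ let $\Sigma^n$ be the finite group generated by the coordinate transpositions $x_i\leftrightarrow x_{i+1}$ ($1\le i\le n-1$) and the reflection $x\mapsto x-\langle x,w\rangle w$ with $w=e_1+e_2+e_3+e_{n+1}$ (i.e. the reflections in all sides of $\Delta^n$ except the side in $x_n=0$); let $\Sigma^2$ be the group of order $2$ generated by $x_1\leftrightarrow x_2$. Define $P^n=\bigcup_{\gamma\in\Sigma^n}\gamma(\Delta^n)$. *)

(* Defs.v *)
From HB Require Import structures.
From mathcomp Require Import all_boot all_order all_algebra.
From mathcomp Require Import all_classical all_reals all_analysis.
Set Implicit Arguments. Unset Strict Implicit. Unset Printing Implicit Defensive.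
Import Order.TTheory GRing.Theory Num.Theory.
Local Open Scope ring_scope.
Local Open Scope classical_set_scope.

(* Points of R^{n+1} are column vectors 'cV[R]_(n.+1); coordinate x_k (1<=k<=n+1)
   is the entry with index k-1; the time coordinate x_{n+1} is index ord_max. *)
Notation vec R n := 'cV[R]_(n.+1).
Notation mat R n := 'M[R]_(n.+1).

Section Hyp.
Variables (R : realType) (n : nat).

Definition coord (x : vec R n) (k : nat) : R := x (inord k.-1) 0.

Definition lor (x y : vec R n) : R :=
  \sum_(i < n.+1) (if i == ord_max then - (x i 0 * y i 0) else x i 0 * y i 0).

Definition Hn : set (vec R n) := [set x | lor x x = -1 /\ 0 < x ord_max 0].

Definition evec (k : nat) : vec R n := \col_(i < n.+1) (if i == inord k.-1 then 1 else 0).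

(* the reflection x |-> x - 2 <x,w>/<w,w> w in the hyperplane orthogonal to w *)
Definition refl (w : vec R n) : mat R n :=
  1%:M - (2 / lor w w) *: (w *m (\row_(j < n.+1)
     (if j == ord_max then - w j 0 else w j 0))).

Definition lorentzian (A : mat R n) : Prop :=
  forall x y : vec R n, lor (A *m x) (A *m y) = lor x y.
Definition positive (A : mat R n) : Prop :=
  forall x : vec R n, lor x x < 0 -> 0 < x ord_max 0 -> 0 < (A *m x) ord_max 0.

Definition Gamma : set (mat R n) :=
  [set A | lorentzian A /\ positive A /\ forall i j, A i j \is a Num.int].
Definition Gamma2 : set (mat R n) :=
  [set A | Gamma A /\ forall i j, ((A i j - (i == j)%:R) / 2) \is a Num.int].

Definition gen (S : set (mat R n)) : set (mat R n) :=
  [set A | exists s : seq (mat R n),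
     (forall B, B \in s -> S B \/ exists C, S C /\ B = invmx C) /\
     A = \prod_(B <- s) B].

Definition Delta : set (vec R n) :=
  [set x | Hn x /\
     (forall k, (1 <= k < n)%N -> coord x k.+1 <= coord x k) /\
     0 <= coord x n /\
     (if (3 <= n)%N then coord x 1 + coord x 2 + coord x 3 <= coord x n.+1
      else coord x 1 + coord x 2 <= coord x n.+1)].

Definition wvec : vec R n := evec 1 + evec 2 + evec 3 + evec n.+1.

Definition Sigma_gens : set (mat R n) :=
  [set A | (exists i, (1 <= i < n)%N /\
               A = tperm_mx (inord i.-1 : 'I_n.+1) (inord i)) \/
           ((3 <= n)%N /\ A = refl wvec)].
Definition Sigma : set (mat R n) := gen Sigma_gens.

Definition Pn : set (vec R n) :=
  [set y | exists A, Sigma A /\ exists x, Delta x /\ y = A *m x].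

(* hyperbolic convex hull of finitely many actual (time-like) and ideal
   (light-like) vertices, represented by future vectors *)
Definition hull (V : seq (vec R n)) : set (vec R n) :=
  [set x | Hn x /\ exists c : 'I_(size V) -> R,
     (forall i, 0 <= c i) /\ x = \sum_(i < size V) c i *: V`_i].

(* P is a polytope (convex polyhedron with finitely many sides and finite
   volume, the latter in the form: convex hull of finitely many actual and ideal
   vertices) whose sides are the P /\ {<x,e> = 0}, e in E, E being the list of
   unit outward normals: P = {x in H^n | <x,e> <= 0 for e in E}, P has nonempty
   interior, and each e in E gives a genuine side (a point of P lying on that
   side only). *)
Definition polytope_with_sides (P : set (vec R n)) (E : seq (vec R n)) : Prop :=
  [/\ forall e, e \in E -> lor e e = 1,
      P = [set x | Hn x /\ forall e, e \in E -> lor x e <= 0],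
      exists x, Hn x /\ forall e, e \in E -> lor x e < 0,
      forall e, e \in E -> exists x, P x /\ lor x e = 0 /\
                  forall f, f \in E -> f != e -> lor x f < 0
    & exists V : seq (vec R n),
        (forall v, v \in V -> lor v v <= 0 /\ 0 < v ord_max 0) /\ P = hull V].

(* sides with normals e, f of P are adjacent: they meet in a ridge, i.e. there
   is an actual or ideal point of (the closure of) P lying on exactly these two
   sides *)
Definition adjacent (E : seq (vec R n)) (e f : vec R n) : Prop :=
  exists p : vec R n, lor p p <= 0 /\ 0 < p ord_max 0 /\
    (forall g, g \in E -> lor p g <= 0) /\ lor p e = 0 /\ lor p f = 0 /\
    (forall g, g \in E -> g != e -> g != f -> lor p g < 0).

(* dihedral angle between adjacent sides with unit outward normals e, f *)
Definition dihedral_angle (e f : vec R n) : R := acos (- lor e f).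

Definition right_angled (E : seq (vec R n)) : Prop :=
  forall e f, e \in E -> f \in E -> e != f -> adjacent E e f ->
    dihedral_angle e f = 0 \/ dihedral_angle e f = pi / 2.

Definition interiorH (P : set (vec R n)) : set (vec R n) :=
  [set x | Hn x /\ exists eps : R, 0 < eps /\
     forall y, Hn y -> (forall i, `|y i 0 - x i 0| < eps) -> P y].

Definition fundamental_polytope (G : set (mat R n)) (P : set (vec R n)) : Prop :=
  (forall A, G A -> A != 1 -> forall x, interiorH P x -> ~ interiorH P (A *m x)) /\
  (forall y, Hn y -> exists A, G A /\ exists x, P x /\ y = A *m x).

End Hyp.

(* Main.v *)
Require Import Defs.
From HB Require Import structures.
From mathcomp Require Import all_boot all_order all_algebra.
From mathcomp Require Import all_classical all_reals all_analysis.
From mathcomp Require Import perm ring lra zify.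
Import Order.TTheory GRing.Theory Num.Theory numFieldNormedType.Exports.
Local Open Scope ring_scope.
Local Open Scope classical_set_scope.
Set Implicit Arguments.
Unset Strict Implicit.
Unset Printing Implicit Defensive.

(** The vector [c = e_1 + ... + e_n + 3 e_(n+1)] is fixed by [Sigma], it is
    time-like for [n <= 8], and the side normals of [Pn] are exactly the integral
    vectors [e] with [<e,e> = 1] and [<e,c> = -1].  As [c] is orthogonal to
    [e - f], distinct normals satisfy [<e,f> <= 0]; testing this against the
    normals [-e_k] and [e_j + e_k + e_(n+1)] shows that the vertices of [Delta]
    satisfy all the inequalities [<x,e> <= 0].  Conversely, if [x] satisfies
    them, then the point of its [Sigma]-orbit that is closest to a chosen
    interior point of the chamber of [Sigma] lies in [Delta].  Moreover
    [<e,f> <= -2] would make [e + f] time-like, so adjacent sides are orthogonal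
    or tangent at infinity.

    An integral vector [y] congruent to [c] modulo 2, of the same norm as [c] and
    with all [<y,e> <= 0], equals [c]: folded into [Delta] it has odd positive
    decreasing entries with [y_1 + y_2 + y_3 <= y_(n+1)], and comparing squares
    leaves only [c].  Any other vector in the [Gamma2]-orbit of [c] is therefore
    moved closer to [c] by the reflection in some side.  This descent makes [Pn]
    the Dirichlet domain of [c], and it shows that the reflections generate
    [Gamma2] up to the stabilizer of [c].  For [n <= 7] this stabilizer is
    trivial, because side normals that are congruent modulo 2 coincide. *)

Lemma sum_cauchy_schwarz (R : realDomainType) (I : Type) (r : seq I)
    (P : pred I) (a b : I -> R) :
  (\sum_(i <- r | P i) a i * b i) ^+ 2 <=
  (\sum_(i <- r | P i) a i ^+ 2) * (\sum_(i <- r | P i) b i ^+ 2).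
Proof.
set A := \sum_(i <- r | P i) a i ^+ 2; set B := \sum_(i <- r | P i) b i ^+ 2.
set C := \sum_(i <- r | P i) a i * b i.
have lagrange : \sum_(i <- r | P i) \sum_(j <- r | P j)
    (a i * b j - a j * b i) ^+ 2 = A * B + B * A - 2 * (C * C).
  rewrite !big_distrlr mulr_sumr -big_split -sumrB; apply: eq_bigr => i _.
  rewrite mulr_sumr -big_split -sumrB; apply: eq_bigr => j _ /=; ring.
have : 0 <= A * B + B * A - 2 * (C * C).
  by rewrite -lagrange; do 2!(apply: sumr_ge0 => ? _); exact: sqr_ge0.
by rewrite expr2 (mulrC B); lra.
Qed.

Lemma finite_set_argmax (R : realDomainType) (T : choiceType) (f : T -> R)
    (A : set T) :
  finite_set A -> A !=set0 -> exists2 x, A x & forall y, A y -> f y <= f x.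
Proof.
move=> /finite_seqP[s ->] [x0 /(seq_tnthP (s := s))[i0 _]].
case: (arg_maxP (fun i => f (tnth (in_tuple s) i)) (erefl : predT i0)) => i _.
move=> i_max; exists (tnth (in_tuple s) i); first exact: mem_tnth.
by move=> y /seq_tnthP[j ->]; exact: i_max.
Qed.

Lemma sum_ord_telescope (V : zmodType) (f : nat -> V) (i n : nat) :
  (i <= n)%N -> \sum_(k < n | (i <= k)%N) (f k - f k.+1) = f i - f n.
Proof.
move=> le_in.
rewrite -(big_geq_mkord i n xpredT (fun k => f k - f k.+1)) -[RHS]opprB.
by rewrite -telescope_sumr // -sumrN; apply: eq_bigr => k _; rewrite opprB.
Qed.

Lemma sum_ord_le_first_two (R : numDomainType) (f : nat -> R) (b : R)
    (n : nat) :
  (1 < n)%N -> (forall i, (2 <= i < n)%N -> f i <= b) ->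
  \sum_(i < n) f i <= f 0%N + f 1%N + (n%:R - 2) * b.
Proof.
move=> n_gt1 f_le; rewrite -(big_mkord xpredT f).
rewrite big_ltn ?(ltnW n_gt1) // big_ltn // addrA lerD2l.
apply: le_trans (_ : \sum_(2 <= i < n) b <= _).
  exact: ler_sum_nat.
by rewrite sumr_const_nat -[_ *+ _]mulr_natl natrB.
Qed.

Lemma sqr_sum_le_eq1 (R : realFieldType) (a b c t N : R) :
  N < 9 -> 1 <= c -> c <= b -> b <= a ->
  a + b + c <= t -> t ^+ 2 <= a ^+ 2 + b ^+ 2 + (N - 2) * c ^+ 2 + (9 - N) ->
  a = 1.
Proof.
move=> N_lt9 c_ge1 le_cb le_ba sum_le t_le.
have sum_sqr_le : (a + b + c) ^+ 2 <= t ^+ 2 by rewrite ler_sqr ?nnegrE; lra.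
have ab_ge : 0 <= a * (b - c) by apply: mulr_ge0; lra.
have bc_ge : 0 <= c * (b - c) by apply: mulr_ge0; lra.
have ac_ge : 0 <= c * (a - c) by apply: mulr_ge0; lra.
have c2_ge : 0 <= (9 - N) * (c ^+ 2 - 1).
  by apply: mulr_ge0; rewrite subr_ge0; [exact: ltW|exact: exprn_ege1].
have ac_eq0 : c * (a - c) = 0.
  by move: sum_sqr_le t_le ac_ge c2_ge; rewrite !expr2; lra.
have c2_eq0 : (9 - N) * (c ^+ 2 - 1) = 0.
  by move: sum_sqr_le t_le ac_ge c2_ge; rewrite !expr2; lra.
have c_eq1 : c = 1.
  move/eqP: c2_eq0; rewrite mulf_eq0 !subr_eq0 (gt_eqF N_lt9) sqrf_eq1 /=.
  by case/orP => /eqP //; lra.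
by move: ac_eq0; rewrite c_eq1; lra.
Qed.

Lemma int_sqr_sub_self_half (R : archiNumFieldType) (a : R) :
  a \is a Num.int -> (a * a - a) / 2 \is a Num.int.
Proof.
move=> /intrP[z ->].
have [m z_half] : exists m, z * z - z = m * 2.
  have [k [->|->]] : exists k, z = 2 * k \/ z = 2 * k + 1.
    by exists (z %/ 2)%Z; lia.
  - by exists (k * (2 * k - 1)); ring.
  - by exists ((2 * k + 1) * k); ring.
by rewrite -intrM -intrB z_half intrM mulfK ?intr_int // pnatr_eq0.
Qed.

(** * Vectors and the Lorentzian form *)

Local Notation time x := (x ord_max 0).
Local Notation integral := (mxOver Num.int_num_subdef).

Section Coordinates.
Variables (R : realType) (n : nat).
Implicit Types (x y z v : vec R n) (f : nat -> R) (k : nat).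

(* Padding with zeros lets [Delta] be described in the same way for [n = 2]
   and [n >= 3]. *)
Definition spatial k x : R := if (k < n)%N then x (inord k) 0 else 0.

Fact spatial_is_linear k : scalar (spatial k).
Proof.
by move=> a x y; rewrite /spatial; case: ifP; rewrite ?mxE ?mulr0 ?addr0.
Qed.
HB.instance Definition _ k :=
  GRing.isLinear.Build R (vec R n) R *%R (spatial k) (spatial_is_linear k).

Lemma spatialD k x y : spatial k (x + y) = spatial k x + spatial k y.
Proof. exact: raddfD. Qed.

Lemma spatialN k x : spatial k (- x) = - spatial k x.
Proof. exact: raddfN. Qed.

Lemma spatialZ k a x : spatial k (a *: x) = a * spatial k x.
Proof. exact: linearZ. Qed.

Lemma timeN x : time (- x) = - time x.
Proof. exact: mxE. Qed.

Lemma spatial_ge k x : (n <= k)%N -> spatial k x = 0.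
Proof. by rewrite /spatial ltnNge => ->. Qed.

Lemma spatialE x (i : 'I_n.+1) : i != ord_max -> x i 0 = spatial i x.
Proof.
move=> i_max; rewrite /spatial ifT; first by rewrite inord_val.
by rewrite ltn_neqAle -ltnS ltn_ord andbT -(inj_eq val_inj) in i_max *.
Qed.

Lemma coord_spatial x k : (k < n)%N -> Defs.coord x k.+1 = spatial k x.
Proof. by rewrite /spatial => ->. Qed.

Lemma coord_time x : Defs.coord x n.+1 = time x.
Proof. by congr (x _ _); apply: val_inj; rewrite /= inordK. Qed.

Lemma spacetime_ext x y :
  (forall k, (k < n)%N -> spatial k x = spatial k y) -> time x = time y ->
  x = y.
Proof.
move=> eq_spatial eq_time; apply/colP => i.
have [-> //|i_max] := eqVneq i ord_max.
rewrite !spatialE //; have [/eq_spatial//|/spatial_ge eq0] := ltnP i n.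
by rewrite !eq0.
Qed.

Definition spacetime f (t : R) : vec R n :=
  \col_i (if i == ord_max then t else f i).

Lemma spatial_spacetime k f t : (k < n)%N -> spatial k (spacetime f t) = f k.
Proof.
move=> kn; rewrite /spatial kn mxE -val_eqE /= inordK ?leqW //.
by rewrite (ltn_eqF kn).
Qed.

Lemma time_spacetime f t : time (spacetime f t) = t.
Proof. by rewrite mxE eqxx. Qed.

Lemma evec_spatial k : (k < n)%N ->
  evec R n k.+1 = spacetime (fun i => (i == k)%:R) 0.
Proof.
move=> kn; apply/colP => i; rewrite !mxE -!val_eqE /= inordK ?leqW //.
have [->|_] := eqVneq (i : nat) n; first by rewrite (gtn_eqF kn).
by case: (i == k :> nat).
Qed.

Lemma evec_time : evec R n n.+1 = spacetime (fun=> 0) 1.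
Proof. by apply/colP => i; rewrite !mxE -!val_eqE /= inordK. Qed.

Lemma spatial_evec j k : (j < n)%N -> spatial k (evec R n j.+1) = (k == j)%:R.
Proof.
move=> jn; rewrite evec_spatial //; have [kn|nk] := ltnP k n.
  exact: spatial_spacetime.
by rewrite spatial_ge // (gtn_eqF (leq_trans jn nk)).
Qed.

Lemma time_evec j : (j < n)%N -> time (evec R n j.+1) = 0.
Proof. by move=> jn; rewrite evec_spatial // time_spacetime. Qed.

Lemma spatial_evec_time k : spatial k (evec R n n.+1) = 0.
Proof.
have [kn|/spatial_ge -> //] := ltnP k n.
by rewrite evec_time spatial_spacetime.
Qed.

Lemma time_evec_time : time (evec R n n.+1) = 1.
Proof. by rewrite evec_time time_spacetime. Qed.

Lemma lorE x y :
  lor x y = \sum_(i < n) spatial i x * spatial i y - time x * time y.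
Proof.
rewrite /lor big_ord_recr /= eqxx; congr (_ + _).
have lt_max (i : 'I_n) : widen_ord (leqnSn n) i != ord_max.
  by rewrite -val_eqE /= (ltn_eqF (ltn_ord i)).
by apply: eq_bigr => i _; rewrite (negPf (lt_max i)) !spatialE.
Qed.

Lemma lorC x y : lor x y = lor y x.
Proof. by rewrite !lorE mulrC; under eq_bigr do rewrite mulrC. Qed.

Fact lor_is_linear x : scalar (lor x).
Proof.
move=> a y z; rewrite !lorE !mxE mulrBr mulr_sumr.
rewrite [\sum_(i < n) spatial i x * _](_ : _ =
    \sum_(i < n) (a * (spatial i x * spatial i y) + spatial i x * spatial i z)).
  by rewrite big_split /=; ring.
by apply: eq_bigr => i _; rewrite linearP /=; ring.
Qed.
HB.instance Definition _ x :=
  GRing.isLinear.Build R (vec R n) R *%R (lor x) (lor_is_linear x).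

Lemma lorDr x y z : lor x (y + z) = lor x y + lor x z.
Proof. exact: raddfD. Qed.

Lemma lorNr x y : lor x (- y) = - lor x y.
Proof. exact: raddfN. Qed.

Lemma lorZr x a y : lor x (a *: y) = a * lor x y.
Proof. exact: linearZ. Qed.

Lemma lorDl x y z : lor (x + y) z = lor x z + lor y z.
Proof. by rewrite !(lorC _ z) lorDr. Qed.

Lemma lorNl x y : lor (- x) y = - lor x y.
Proof. by rewrite !(lorC _ y) lorNr. Qed.

Lemma lorZl a x y : lor (a *: x) y = a * lor x y.
Proof. by rewrite !(lorC _ y) lorZr. Qed.

Definition lor_bilinear := (lorDr, lorNr, lorZr, lorDl, lorNl, lorZl).

Lemma lor_suml (I : Type) (r : seq I) (P : pred I) (F : I -> vec R n) y :
  lor (\sum_(i <- r | P i) F i) y = \sum_(i <- r | P i) lor (F i) y.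
Proof. by rewrite lorC linear_sum; apply: eq_bigr => i _; rewrite lorC. Qed.

Lemma lor_spacetime x f t :
  lor x (spacetime f t) = \sum_(i < n) spatial i x * f i - time x * t.
Proof.
rewrite lorE time_spacetime; congr (_ - _).
by apply: eq_bigr => i _; rewrite spatial_spacetime.
Qed.

Lemma lor_evec x k : (k < n)%N -> lor x (evec R n k.+1) = spatial k x.
Proof.
move=> kn; rewrite evec_spatial // lor_spacetime mulr0 subr0.
rewrite (bigD1 (Ordinal kn)) //= eqxx mulr1 big1 ?addr0 // => i.
by rewrite -val_eqE /= => /negPf ->; rewrite mulr0.
Qed.

Lemma lor_evec_time x : lor x (evec R n n.+1) = - time x.
Proof.
by rewrite evec_time lor_spacetime mulr1 big1 ?sub0r // => i _; rewrite mulr0.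
Qed.

Lemma lor_nondegenerate x y : (forall z, lor x z = lor y z) -> x = y.
Proof.
move=> eq_lor; apply: spacetime_ext => [k kn|]; first by rewrite -!lor_evec.
by apply: oppr_inj; rewrite -!lor_evec_time.
Qed.

End Coordinates.

Section CausalVectors.
Variables (R : realType) (n : nat).
Implicit Types (x y v : vec R n).

Definition spatial_norm x : R := Num.sqrt (\sum_(i < n) spatial i x ^+ 2).

Lemma spatial_norm_ge0 x : 0 <= spatial_norm x.
Proof. exact: sqrtr_ge0. Qed.

Lemma sqr_spatial_norm x : spatial_norm x ^+ 2 = \sum_(i < n) spatial i x ^+ 2.
Proof. by rewrite sqr_sqrtr // sumr_ge0 // => i _; exact: sqr_ge0. Qed.

Lemma lor_sqr x : lor x x = spatial_norm x ^+ 2 - time x ^+ 2.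
Proof. by rewrite lorE sqr_spatial_norm expr2. Qed.

Lemma causalE x : (lor x x <= 0) = (spatial_norm x <= `|time x|).
Proof.
rewrite lor_sqr subr_le0 -(real_normK (num_real (time x))).
by rewrite ler_sqr ?nnegrE ?spatial_norm_ge0.
Qed.

Lemma timelikeE x : (lor x x < 0) = (spatial_norm x < `|time x|).
Proof.
rewrite lor_sqr subr_lt0 -(real_normK (num_real (time x))).
by rewrite ltr_sqr ?nnegrE ?spatial_norm_ge0.
Qed.

Lemma spatial_le_spatial_norm k x : `|spatial k x| <= spatial_norm x.
Proof.
have [kn|/spatial_ge ->] := ltnP k n; last by rewrite normr0 spatial_norm_ge0.
rewrite -ler_sqr ?nnegrE ?spatial_norm_ge0 // real_normK ?num_real //.
rewrite sqr_spatial_norm (bigD1 (Ordinal kn)) //= lerDl.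
by apply: sumr_ge0 => i _; exact: sqr_ge0.
Qed.

Lemma spatial_cauchy_schwarz x y :
  `|lor x y + time x * time y| <= spatial_norm x * spatial_norm y.
Proof.
rewrite lorE subrK -ler_sqr ?nnegrE ?mulr_ge0 ?spatial_norm_ge0 //.
by rewrite real_normK ?num_real // exprMn !sqr_spatial_norm sum_cauchy_schwarz.
Qed.

Definition future_causal x : Prop := lor x x <= 0 /\ 0 < time x.
Definition future_timelike x : Prop := lor x x < 0 /\ 0 < time x.

Lemma timelike_causal x : future_timelike x -> future_causal x.
Proof. by case=> /ltW. Qed.

Lemma Hn_timelike x : Hn x -> future_timelike x.
Proof. by case=> xx; split; rewrite ?xx ?ltrN10. Qed.

(* For time-like [y] the right-hand side bounds the height of [v]. *)
Lemma causal_lor_le v y : future_causal v ->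
  lor v y <= - (time v * (time y - spatial_norm y)).
Proof.
move=> [+ v_future]; rewrite causalE gtr0_norm // => v_causal.
have := le_trans (ler_norm _) (spatial_cauchy_schwarz v y).
have := ler_wpM2r (spatial_norm_ge0 y) v_causal.
by rewrite mulrBr; lra.
Qed.

Lemma timelike_gap_gt0 y : future_timelike y -> 0 < time y - spatial_norm y.
Proof. by case; rewrite timelikeE subr_gt0 => + y0; rewrite gtr0_norm. Qed.

Lemma causal_timelike_lor_lt0 v y :
  future_causal v -> future_timelike y -> lor v y < 0.
Proof.
move=> v_causal /timelike_gap_gt0 gap; have [_ v_future] := v_causal.
by apply: le_lt_trans (causal_lor_le y v_causal) _; rewrite oppr_lt0 mulr_gt0.
Qed.

Lemma causal_time_eq0 v : lor v v <= 0 -> time v = 0 -> v = 0.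
Proof.
rewrite causalE => v_causal time0; rewrite time0 normr0 in v_causal.
apply: spacetime_ext => [k _|]; last by rewrite time0 mxE.
rewrite raddf0; apply/eqP; rewrite -normr_le0.
exact: le_trans (spatial_le_spatial_norm k v) v_causal.
Qed.

Lemma orthogonal_timelike_lor_gt0 v y :
  lor y y < 0 -> lor v y = 0 -> v != 0 -> 0 < lor v v.
Proof.
rewrite timelikeE => y_timelike vy; apply: contraNT; rewrite -leNgt => v_causal.
apply/eqP/causal_time_eq0 => //; apply/eqP; rewrite -normr_le0.
have := spatial_cauchy_schwarz v y; rewrite vy add0r normrM.
rewrite causalE in v_causal.
move/le_trans/(_ (ler_wpM2r (spatial_norm_ge0 y) v_causal)).
by rewrite -subr_le0 -mulrBr pmulr_lle0 // subr_gt0.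
Qed.

Lemma reverse_cauchy_schwarz v y :
  lor y y < 0 -> lor v v * lor y y <= lor v y ^+ 2.
Proof.
move=> y_timelike; have yy_neq0 : lor y y != 0 by rewrite lt_eqF.
pose w := v - (lor v y / lor y y) *: y.
have wy : lor w y = 0 by rewrite !lor_bilinear divfK ?subrr.
have ww : lor w w * lor y y = lor v v * lor y y - lor v y ^+ 2.
  by rewrite !lor_bilinear (lorC y v); field.
rewrite -subr_le0 -ww; have [->|w_neq0] := eqVneq w 0.
  by rewrite linear0 mul0r.
rewrite nmulr_lle0 // ltW //.
exact: orthogonal_timelike_lor_gt0 y_timelike wy w_neq0.
Qed.

Lemma future_causal_lor_lt0 v y :
  lor v v <= 0 -> future_timelike y -> lor v y < 0 -> future_causal v.
Proof.
move=> v_causal y_timelike vy; split=> //.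
have [//|v_past|time0] := ltgtP 0 (time v); last first.
  have v0 := causal_time_eq0 v_causal (esym time0).
  by rewrite v0 lorC linear0 ltxx in vy.
have /causal_timelike_lor_lt0/(_ y_timelike) : future_causal (- v).
  by split; rewrite ?timeN ?oppr_gt0 // !lor_bilinear opprK.
by rewrite lor_bilinear oppr_lt0 => /(lt_trans vy); rewrite ltxx.
Qed.

End CausalVectors.

(** * Integral isometries *)

Section Integrality.
Variables (R : realType) (n : nat).
Implicit Types (x y z v : vec R n).

Lemma spatial_int k x : x \is a integral -> spatial k x \is a Num.int.
Proof.
by move=> /mxOverP x_int; rewrite /spatial; case: ifP; rewrite ?x_int ?rpred0.
Qed.

Lemma time_int x : x \is a integral -> time x \is a Num.int.
Proof. by move/mxOverP. Qed.

Lemma spacetime_integral (f : nat -> R) (t : R) :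
  (forall k, f k \is a Num.int) -> t \is a Num.int ->
  spacetime n f t \is a integral.
Proof. by move=> f_int t_int; apply/mxOverP => i j; rewrite mxE; case: ifP. Qed.

Lemma evec_integral k : evec R n k \is a integral.
Proof. by apply/mxOverP => i j; rewrite mxE; case: ifP. Qed.

Lemma lor_int x y :
  x \is a integral -> y \is a integral -> lor x y \is a Num.int.
Proof.
move=> x_int y_int; rewrite lorE rpredB ?rpred_sum // => [i _|];
  by rewrite rpredM ?spatial_int ?time_int.
Qed.

(* The Lorentzian lattice is unimodular. *)
Lemma integral_lorP v :
  (forall z, z \is a integral -> lor v z \is a Num.int) -> v \is a integral.
Proof.
move=> lor_v; apply/mxOverP => i j; rewrite ord1.
have [->|i_max] := eqVneq i ord_max.
  by rewrite -[time v]opprK -lor_evec_time rpredN lor_v // evec_integral.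
rewrite spatialE //.
have [lt_in|/spatial_ge ->] := ltnP i n; last exact: rpred0.
by rewrite -lor_evec // lor_v // evec_integral.
Qed.

Definition even p q (A : 'M[R]_(p, q)) : Prop :=
  exists2 B, B \is a integral & A = 2 *: B.

Lemma evenD p q (A B : 'M[R]_(p, q)) : even A -> even B -> even (A + B).
Proof.
by move=> [C ? ->] [D ? ->]; exists (C + D); rewrite ?rpredD ?scalerDr.
Qed.

Lemma evenN p q (A : 'M[R]_(p, q)) : even A -> even (- A).
Proof. by move=> [B ? ->]; exists (- B); rewrite ?rpredN ?scalerN. Qed.

Lemma even_mulmxl p q r (A : 'M[R]_(p, q)) (B : 'M[R]_(q, r)) :
  A \is a integral -> even B -> even (A *m B).
Proof.
by move=> A_int [C ? ->]; exists (A *m C); rewrite ?mxOverM // -scalemxAr.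
Qed.

Lemma even_mulmxr p q r (A : 'M[R]_(p, q)) (B : 'M[R]_(q, r)) :
  even A -> B \is a integral -> even (A *m B).
Proof.
by move=> [C ? ->] B_int; exists (C *m B); rewrite ?mxOverM // -scalemxAl.
Qed.

End Integrality.

Section LorentzGroup.
Variables (R : realType) (n : nat).
Implicit Types (x y z v : vec R n) (A B C : mat R n) (G S : set (mat R n)).

Lemma mulmx_ext A B : (forall x, A *m x = B *m x) -> A = B.
Proof.
move=> eqAB; apply/matrixP => i j.
by have := eqAB (delta_mx j 0); rewrite -!colE => /colP/(_ i); rewrite !mxE.
Qed.

Lemma lorentzian_unitmx A : lorentzian A -> A \in unitmx.
Proof.
move=> A_lor; rewrite unitmxE unitfE -det_tr.
apply/det0P => -[v /negP v_neq0 vA]; apply: v_neq0.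
rewrite -trmx_eq0; apply/eqP/lor_nondegenerate => z.
by rewrite -A_lor -[A]trmxK -trmx_mul vA trmx0 !(lorC 0) !linear0.
Qed.

Lemma lor_mulmx_invmx A x y :
  lorentzian A -> lor (A *m x) y = lor x (invmx A *m y).
Proof.
by move=> A_lor; rewrite -[RHS]A_lor mulKVmx // lorentzian_unitmx.
Qed.

Lemma evec_time_timelike : future_timelike (evec R n n.+1).
Proof. by rewrite /future_timelike lor_evec_time time_evec_time ltrN10. Qed.

Lemma future_timelike_mulmx A v :
  lorentzian A -> positive A -> future_timelike v -> future_timelike (A *m v).
Proof.
by move=> A_lor A_pos [vv v_future]; split; [rewrite A_lor|exact: A_pos].
Qed.

Lemma future_causal_mulmx A v :
  lorentzian A -> positive A -> future_causal v -> future_causal (A *m v).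
Proof.
move=> A_lor A_pos v_causal; have e_timelike := evec_time_timelike.
apply: (future_causal_lor_lt0 (y := A *m evec R n n.+1)).
- by rewrite A_lor; case: v_causal.
- exact: future_timelike_mulmx.
- by rewrite A_lor; exact: causal_timelike_lor_lt0.
Qed.

Lemma lorentzian_invmx A : lorentzian A -> lorentzian (invmx A).
Proof.
by move=> A_lor x y; rewrite -A_lor !mulKVmx // lorentzian_unitmx.
Qed.

Lemma positive_invmx A : lorentzian A -> positive A -> positive (invmx A).
Proof.
move=> A_lor A_pos x xx x_future; have e_timelike := evec_time_timelike.
suff [] : future_causal (invmx A *m x) by [].
apply: (future_causal_lor_lt0 _ e_timelike).
  by rewrite lorentzian_invmx // ltW.
rewrite lorC -lor_mulmx_invmx // lorC; apply: causal_timelike_lor_lt0.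
  exact: timelike_causal.
exact: future_timelike_mulmx.
Qed.

Lemma integral_invmx A :
  lorentzian A -> A \is a integral -> invmx A \is a integral.
Proof.
move=> A_lor A_int; apply/mxOverP => i j.
have : col j (invmx A) \is a integral.
  apply: integral_lorP => z z_int; rewrite colE lorC -lor_mulmx_invmx //.
  apply: lor_int; first exact: mxOverM.
  by apply/mxOverP => ? ?; rewrite mxE.
by move/mxOverP/(_ i 0); rewrite mxE.
Qed.

Definition matrix_group G : Prop :=
  [/\ G 1, forall A B, G A -> G B -> G (A * B) & forall A, G A -> G (invmx A)].

Lemma GammaP A :
  Gamma A <-> [/\ lorentzian A, positive A & A \is a integral].
Proof.
by split=> [[? [? /mxOverP ?]]|[? ? /mxOverP ?]]; split.
Qed.

Lemma Gamma_group : matrix_group (@Gamma R n).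
Proof.
split.
- apply/GammaP; split=> [x y|x _|]; rewrite ?mul1mx //.
  exact: mxOver_scalar.
- move=> A B /GammaP[A_lor A_pos A_int] /GammaP[B_lor B_pos B_int].
  apply/GammaP; split=> [x y|x xx x_future|]; last exact: mxOverM.
    by rewrite -!mulmxA A_lor B_lor.
  by rewrite -mulmxA; apply: A_pos; [rewrite B_lor|exact: B_pos].
- move=> A /GammaP[A_lor A_pos A_int]; apply/GammaP; split.
  + exact: lorentzian_invmx.
  + exact: positive_invmx.
  + exact: integral_invmx.
Qed.

Lemma Gamma_unitmx A : Gamma A -> A \in unitmx.
Proof. by case/GammaP => /lorentzian_unitmx. Qed.

Lemma Gamma2P A : Gamma2 A <-> Gamma A /\ even (A - 1).
Proof.
split=> -[A_Gamma A_even]; split=> //.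
  exists (2^-1 *: (A - 1)); last by rewrite scalerA divff // scale1r.
  by apply/mxOverP => i j; have := A_even i j; rewrite !mxE mulrC.
move=> i j; have [B /mxOverP B_int /matrixP/(_ i j)] := A_even.
by rewrite !mxE => ->; rewrite mulrC mulKf // B_int.
Qed.

Lemma Gamma2_group : matrix_group (@Gamma2 R n).
Proof.
have [Gamma1 GammaM GammaV] := Gamma_group; split.
- apply/Gamma2P; split=> //; exists 0; rewrite ?rpred0 //.
  by rewrite subrr scaler0.
- move=> A B /Gamma2P[A_Gamma A_even] /Gamma2P[B_Gamma B_even].
  apply/Gamma2P; split; first exact: GammaM.
  have -> : A * B - 1 = A *m (B - 1) + (A - 1).
    by rewrite mulmxBr mulmx1 addrA subrK.
  by apply: evenD => //; apply: even_mulmxl => //; case/GammaP: A_Gamma.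
- move=> A /Gamma2P[A_Gamma A_even]; have AV_Gamma := GammaV _ A_Gamma.
  apply/Gamma2P; split=> //.
  have -> : invmx A - 1 = - (invmx A *m (A - 1)).
    by rewrite mulmxBr mulVmx ?Gamma_unitmx // mulmx1 opprB.
  by apply/evenN/even_mulmxl => //; case/GammaP: AV_Gamma.
Qed.

Lemma Gamma2_even A v : Gamma2 A -> v \is a integral -> even (A *m v - v).
Proof.
move=> /Gamma2P[_ A_even] v_int.
have -> : A *m v - v = (A - 1) *m v by rewrite mulmxBl mul1mx.
exact: even_mulmxr.
Qed.

Lemma stabilizer_group G v :
  matrix_group G -> G `<=` [set` unitmx] ->
  matrix_group [set A | G A /\ A *m v = v].
Proof.
move=> [G1 GM GV] G_unit; split=> [|A B [GA Av] [GB Bv]|A [GA Av]].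
- by split; rewrite ?mul1mx.
- by split; [exact: GM|rewrite -mulmxA Bv].
- by split; [exact: GV|rewrite -{1}Av mulKmx ?G_unit].
Qed.

Lemma gen_base S A : S A -> gen S A.
Proof.
move=> SA; exists [:: A]; rewrite big_seq1; split=> // B.
by rewrite inE => /eqP ->; left.
Qed.

Lemma gen_invmx_base S A : S A -> gen S (invmx A).
Proof.
move=> SA; exists [:: invmx A]; rewrite big_seq1; split=> // B.
by rewrite inE => /eqP ->; right; exists A.
Qed.

Lemma gen1 S : gen S 1.
Proof. by exists [::]; rewrite big_nil. Qed.

Lemma genM S A B : gen S A -> gen S B -> gen S (A * B).
Proof.
move=> [s [sS ->]] [t [tS ->]]; exists (s ++ t); rewrite big_cat; split=> // C.
by rewrite mem_cat => /orP[/sS|/tS].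
Qed.

Lemma gen_least S G : matrix_group G -> S `<=` G -> gen S `<=` G.
Proof.
move=> [G1 GM GV] SG _ [s [sS ->]]; rewrite big_seq; elim/big_ind: _ => //.
by move=> B /sS[/SG//|[C [/SG/GV SC ->]]].
Qed.

Lemma gen_group S : S `<=` [set` unitmx] -> matrix_group (gen S).
Proof.
move=> S_unit; split; [exact: gen1|exact: genM|].
suff genV : gen S `<=` [set A | [/\ A \in unitmx, gen S A & gen S (invmx A)]].
  by move=> A /genV[].
apply: gen_least => [|A SA]; last first.
  by split; [exact: S_unit|exact: gen_base|exact: gen_invmx_base].
split=> [|A B [uA gA gAV] [uB gB gBV]|A [uA gA gAV]].
- by split; rewrite ?invmx1 ?unitmx1; try exact: gen1.
- split; [by rewrite unitmx_mul uA|exact: genM|].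
  by rewrite [invmx _](invrM uA uB); exact: genM.
- by split; rewrite ?unitmx_inv ?invmxK.
Qed.

End LorentzGroup.

(** * Reflections and orbits *)

Section Reflections.
Variables (R : realType) (n : nat).
Implicit Types (x y z w u : vec R n).

Lemma mulmx_refl w x : refl w *m x = x - (2 * lor x w / lor w w) *: w.
Proof.
rewrite /refl mulmxBl mul1mx -scalemxAl -mulmxA.
rewrite [X in w *m X](_ : _ = (lor x w)%:M).
  by rewrite mul_mx_scalar scalerA mulrAC.
apply/matrixP => i j; rewrite !ord1 !mxE eqxx mulr1n; apply: eq_bigr => k _.
by rewrite !mxE; case: ifP => _; ring.
Qed.

Lemma lorentzian_refl w : lor w w != 0 -> lorentzian (refl w).
Proof.
by move=> ww x y; rewrite !mulmx_refl !lor_bilinear (lorC w y); field.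
Qed.

Lemma refl_involutive w : lor w w != 0 -> refl w * refl w = 1.
Proof.
move=> ww; apply: mulmx_ext => x.
rewrite -mulmxA mul1mx !mulmx_refl !lor_bilinear.
rewrite -addrA -opprD -scalerDl [X in X *: w](_ : _ = 0).
  by rewrite scale0r subr0.
by field.
Qed.

Lemma refl_unitmx w : lor w w != 0 -> refl w \in unitmx.
Proof. by move=> /refl_involutive/mulmx1_unit[]. Qed.

Lemma refl_fixed w x : lor x w = 0 -> refl w *m x = x.
Proof. by move=> xw; rewrite mulmx_refl xw mulr0 mul0r scale0r subr0. Qed.

Lemma positive_refl w : 0 < lor w w -> positive (refl w).
Proof.
move=> ww x xx x_future.
have refl_lor : lorentzian (refl w) by apply: lorentzian_refl; rewrite gt_eqF.
suff [] : future_causal (refl w *m x) by [].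
apply: (future_causal_lor_lt0 (y := x)) => //; first by rewrite refl_lor ltW.
rewrite mulmx_refl !lor_bilinear (lorC w x).
have -> : 2 * lor x w / lor w w * lor x w = 2 * (lor x w ^+ 2 / lor w w).
  by field; rewrite gt_eqF.
have := divr_ge0 (sqr_ge0 (lor x w)) (ltW ww).
by move: (_ / _) => r; lra.
Qed.

Lemma refl_integral_dyad w : w \is a integral ->
  exists2 B, B \is a integral & refl w = 1 - (2 / lor w w) *: B.
Proof.
move=> w_int; eexists; last by [].
apply: mxOverM => //; apply/mxOverP => i j; rewrite mxE.
by case: ifP => _; rewrite ?rpredN (mxOverP w_int).
Qed.

Lemma Gamma_refl w : w \is a integral -> 0 < lor w w ->
  2 / lor w w \is a Num.int -> Gamma (refl w).
Proof.
move=> w_int ww w_cryst; apply/GammaP; split.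
- by apply: lorentzian_refl; rewrite gt_eqF.
- exact: positive_refl.
- have [B B_int ->] := refl_integral_dyad w_int.
  apply/mxOverP => i j; rewrite !mxE rpredB ?rpred_nat // rpredM //.
  exact: (mxOverP B_int).
Qed.

Lemma Gamma2_refl w : w \is a integral -> lor w w = 1 -> Gamma2 (refl w).
Proof.
move=> w_int ww; apply/Gamma2P; split.
  by apply: Gamma_refl => //; rewrite ww ?divr1 ?rpred_nat.
have [B B_int ->] := refl_integral_dyad w_int; exists (- B); rewrite ?rpredN //.
by rewrite ww divr1 addrAC subrr sub0r scalerN.
Qed.

(* As [lor x y] is minus the hyperbolic cosine of the distance from [x] to [y],
   this says when the reflection brings [z] closer to [u]. *)
Lemma lor_refl_gt w z u : 0 < lor w w ->
  (lor z u < lor (refl w *m z) u) = (lor z w * lor u w < 0).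
Proof.
move=> ww; rewrite mulmx_refl !lor_bilinear (lorC w u) ltrDl oppr_gt0.
have -> : 2 * lor z w / lor w w * lor u w = 2 / lor w w * (lor z w * lor u w).
  by field; rewrite gt_eqF.
by rewrite pmulr_rlt0 // divr_gt0.
Qed.

Lemma lor_refl_le_lor_le0 w z u : 0 < lor w w -> lor u w < 0 ->
  lor (refl w *m z) u <= lor z u -> lor z w <= 0.
Proof.
by move=> ww uw; rewrite leNgt lor_refl_gt // -leNgt nmulr_lge0.
Qed.

End Reflections.

Section IntegralCausalVectors.
Variables (R : realType) (n : nat).
Implicit Types (u v y : vec R n) (A B : mat R n).

Lemma integral_bounded_finite (b : R) :
  finite_set [set v : vec R n | v \is a integral /\ forall i, `|v i 0| <= b].
Proof.
pose m := Num.bound `|b|.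
pose F (f : {ffun 'I_n.+1 -> 'I_(2 * m).+1}) : vec R n :=
  \col_i ((f i)%:Z - m%:Z)%:~R.
apply: (@sub_finite_set _ _ [set` codom F]); last exact: finite_seq.
move=> v [/mxOverP v_int v_le] /=.
suff -> : v = F [ffun i => inord `|Num.floor (v i 0) + m%:Z|] by exact: codom_f.
apply/colP => i; rewrite mxE ffunE.
have /intrP[z v_i] := v_int i 0.
have : `|v i 0| <= m%:Z%:~R.
  apply/ltW/(le_lt_trans (v_le i))/(le_lt_trans (ler_norm b)).
  exact: archi_boundP.
rewrite v_i intrKfloor -intr_norm ler_int => z_le; congr _%:~R.
by rewrite inordK; lia.
Qed.

Lemma integral_causal_finite y (b : R) : future_timelike y ->
  finite_set [set v | [/\ v \is a integral, future_causal v & b <= lor v y]].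
Proof.
move=> /timelike_gap_gt0 gap; apply: sub_finite_set
  (integral_bounded_finite (- b / (time y - spatial_norm y))).
move=> v [v_int v_causal v_le]; split=> // i.
have [+ v_future] := v_causal; rewrite causalE gtr0_norm // => norm_le.
apply: le_trans (_ : time v <= _).
  have [->|i_max] := eqVneq i ord_max; first by rewrite gtr0_norm.
  by rewrite spatialE //; exact: le_trans (spatial_le_spatial_norm i v) norm_le.
rewrite ler_pdivlMr //; have := causal_lor_le y v_causal.
by move: (_ * _) => r; lra.
Qed.

Lemma integral_causal_argmax y (T : set (vec R n)) : future_timelike y ->
  (forall v, T v -> v \is a integral /\ future_causal v) -> T !=set0 ->
  exists2 v, T v & forall u, T u -> lor u y <= lor v y.
Proof.
move=> y_timelike T_causal [v0 Tv0].
have [||v [Tv v0_le] v_max] := @finite_set_argmax _ _ (fun v => lor v y)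
    [set v | T v /\ lor v0 y <= lor v y].
- apply: sub_finite_set (integral_causal_finite (lor v0 y) y_timelike).
  by move=> v [/T_causal[]].
- by exists v0.
exists v => // u Tu; have [lt_u|le_u] := ltP (lor u y) (lor v0 y).
  exact: ltW (lt_le_trans lt_u v0_le).
exact: v_max.
Qed.

Lemma Gamma_orbit_argmax (G : set (mat R n)) u y :
  G `<=` @Gamma R n -> G !=set0 ->
  u \is a integral -> future_causal u -> future_timelike y ->
  exists2 A, G A & forall B, G B -> lor (B *m y) u <= lor (A *m y) u.
Proof.
move=> G_Gamma [A0 GA0] u_int u_causal y_timelike.
have [_ _ GammaV] := Gamma_group R n.
have [||_ [A GA <-] A_max] := integral_causal_argmax y_timelike
    (T := [set invmx A *m u | A in G]).
- move=> _ [A /G_Gamma/GammaV/GammaP[AV_lor AV_pos AV_int] <-].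
  by split; [exact: mxOverM|exact: future_causal_mulmx].
- by exists (invmx A0 *m u), A0.
have lor_pullback B : G B -> lor (B *m y) u = lor (invmx B *m u) y.
  by move=> /G_Gamma/GammaP[B_lor _ _]; rewrite lor_mulmx_invmx // lorC.
by exists A => // B GB; rewrite !lor_pullback //; apply: A_max; exists B.
Qed.

End IntegralCausalVectors.

Section Interior.
Variables (R : realType) (n : nat).
Implicit Types (x y v e : vec R n) (P : set (vec R n)).

Definition normalize v : vec R n := (Num.sqrt (- lor v v))^-1 *: v.

Lemma sqrt_norm_gt0 v : lor v v < 0 -> 0 < (Num.sqrt (- lor v v))^-1.
Proof. by move=> vv; rewrite invr_gt0 sqrtr_gt0 oppr_gt0. Qed.

Lemma normalize_Hn v : future_timelike v -> Hn (normalize v).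
Proof.
move=> [vv v_future]; split; last by rewrite mxE mulr_gt0 ?sqrt_norm_gt0.
have := sqrt_norm_gt0 vv; rewrite /normalize invr_gt0.
set r := Num.sqrt _ => r_gt0.
have vvE : lor v v = - r ^+ 2 by rewrite sqr_sqrtr ?opprK // oppr_ge0 ltW.
by rewrite !lor_bilinear vvE; field; rewrite gt_eqF.
Qed.

Lemma lor_normalize_lt0 v e : lor v v < 0 ->
  (lor (normalize v) e < 0) = (lor v e < 0).
Proof. by move=> vv; rewrite lorZl pmulr_rlt0 // sqrt_norm_gt0. Qed.

Lemma lor_normalize_le0 v e : lor v v < 0 ->
  (lor (normalize v) e <= 0) = (lor v e <= 0).
Proof. by move=> vv; rewrite lorZl pmulr_rle0 // sqrt_norm_gt0. Qed.

Lemma lor_normalize_eq0 v e : lor v e = 0 -> lor (normalize v) e = 0.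
Proof. by move=> ve; rewrite lorZl ve mulr0. Qed.

Lemma interiorH_near P x : interiorH P x ->
  Hn x /\ \forall y \near x, Hn y -> P y.
Proof.
move=> [Hx [eps [eps0 ball_P]]]; split=> //; apply/nbhs_ballP.
exists eps => //= y [_ xy] Hy; apply: ball_P => // i.
by have := xy i 0; rewrite /ball /= distrC.
Qed.

Lemma lor_continuous : continuous (fun x => lor x x).
Proof.
have sqr_continuous (i : 'I_n.+1) :
    continuous (fun x : vec R n => x i 0 * x i 0).
  by move=> x; apply: continuousM; exact: coord_continuous.
apply: continuous_big => [|i _]; first exact: add_continuous.
have [_|_] := eqVneq i ord_max => x; last exact: sqr_continuous.
exact: cvgN (sqr_continuous i x).
Qed.

Lemma future_timelike_near x :
  future_timelike x -> \forall y \near x, future_timelike y.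
Proof.
move=> [xx x_future]; near=> y; split; near: y.
  exact: cvgr_lt _ (@lor_continuous x) _ xx.
exact: cvgr_gt _ (@coord_continuous R n.+1 1 ord_max 0 x) _ x_future.
Unshelve. all: by end_near. Qed.

Lemma normalize_id x : Hn x -> normalize x = x.
Proof. by move=> [xx _]; rewrite /normalize xx opprK sqrtr1 invr1 scale1r. Qed.

Lemma normalize_continuous x :
  future_timelike x -> {for x, continuous normalize}.
Proof.
move=> [xx _]; apply: continuousZ; last exact: cvg_id.
apply: continuousV; first by rewrite gt_eqF // sqrtr_gt0 oppr_gt0.
apply: continuous_comp; last exact: sqrt_continuous.
exact: cvgN (lor_continuous (x := x)).
Qed.

Lemma interiorH_line P x v : interiorH P x ->
  \forall t \near (0 : R),
    future_timelike (x + t *: v) /\ P (normalize (x + t *: v)).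
Proof.
move=> /interiorH_near[Hx near_P].
have line_cvg : x + t *: v @[t --> (0 : R)] --> x.
  suff : x + t *: v @[t --> (0 : R)] --> x + 0 *: v by rewrite scale0r addr0.
  by apply: cvgD; [exact: cvg_cst|apply: cvgZr_tmp; exact: cvg_id].
apply: (line_cvg [set y | future_timelike y /\ P (normalize y)]); near=> y.
have y_timelike : future_timelike y.
  by near: y; exact: future_timelike_near (Hn_timelike Hx).
split=> //; move: (normalize_Hn y_timelike); near: y.
have : normalize @ x --> normalize x.
  exact: normalize_continuous (Hn_timelike Hx).
by rewrite [normalize x]normalize_id // => /(_ _ near_P).
Unshelve. all: by end_near. Qed.

(* Otherwise moving [x] in direction [e] leaves [P]. *)
Lemma interiorH_lor_lt0 P x e :
  interiorH P x -> (forall y, P y -> lor y e <= 0) -> lor e e = 1 ->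
  lor x e < 0.
Proof.
move=> /(interiorH_line e)/nbhs_ballP[eps /= eps_gt0 near_P] P_le0 ee.
have [|t_timelike /P_le0] := near_P (eps / 2).
  by rewrite /ball /= sub0r normrN gtr0_norm; lra.
rewrite lor_normalize_le0; last by case: t_timelike.
by rewrite lorDl lorZl ee; lra.
Qed.

End Interior.

(** * The center and the side normals *)

Section Center.
Variables (R : realType) (n : nat).
Implicit Types (x v : vec R n).

(* Up to sign and coordinate order, this is the canonical class of the blow-up
   of the plane at [n] points; the side normals below are the classes of the
   exceptional curves on it. *)
Definition Pn_center : vec R n := spacetime n (fun=> 1) 3.

Lemma time_center : time Pn_center = 3.
Proof. exact: time_spacetime. Qed.

Lemma spatial_center k : (k < n)%N -> spatial k Pn_center = 1.
Proof. exact: spatial_spacetime. Qed.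

Lemma lor_center x : lor x Pn_center = \sum_(i < n) spatial i x - 3 * time x.
Proof. by rewrite lor_spacetime mulrC; under eq_bigr do rewrite mulr1. Qed.

Lemma lor_center_center : lor Pn_center Pn_center = n%:R - 9.
Proof.
rewrite lor_center time_center (eq_bigr (fun=> 1)) => [|i _]; last first.
  by rewrite spatial_center.
by rewrite sumr_const card_ord; ring.
Qed.

Lemma center_integral : Pn_center \is a integral.
Proof. by apply: spacetime_integral. Qed.

Lemma center_timelike : (n < 9)%N -> future_timelike Pn_center.
Proof.
move=> n_lt9; split; last by rewrite time_center.
by rewrite lor_center_center subr_lt0 ltr_nat.
Qed.

(* All entries of the center are odd, so it is a characteristic vector. *)
Lemma center_characteristic v :
  v \is a integral -> (lor v v - lor v Pn_center) / 2 \is a Num.int.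
Proof.
move=> v_int; rewrite lorE lor_center.
have -> : (\sum_(i < n) spatial i v * spatial i v - time v * time v -
    (\sum_(i < n) spatial i v - 3 * time v)) / 2 =
  \sum_(i < n) (spatial i v * spatial i v - spatial i v) / 2 -
    (time v * time v - time v) / 2 + time v.
  by rewrite -mulr_suml sumrB; field.
rewrite rpredD ?time_int // rpredB ?int_sqr_sub_self_half ?time_int //.
by rewrite rpred_sum // => i _; rewrite int_sqr_sub_self_half ?spatial_int.
Qed.

End Center.
Arguments Pn_center {R n}.

Section SideNormals.
Variables (R : realType) (n : nat).
Implicit Types (x e f : vec R n) (A : mat R n).

Definition side_normal e : Prop :=
  [/\ e \is a integral, lor e e = 1 & lor e Pn_center = -1].

Definition side_cone x : Prop := forall e, side_normal e -> lor x e <= 0.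

Definition center_stabilizer : set (mat R n) :=
  [set A | Gamma A /\ A *m Pn_center = Pn_center].

Lemma center_stabilizer_group : matrix_group center_stabilizer.
Proof. exact: stabilizer_group (Gamma_group R n) (@Gamma_unitmx R n). Qed.

Lemma side_normal_mulmx A e :
  center_stabilizer A -> side_normal e -> side_normal (A *m e).
Proof.
move=> [/GammaP[A_lor _ A_int] Ac] [e_int ee ec]; split; first exact: mxOverM.
- by rewrite A_lor.
- by rewrite -Ac A_lor.
Qed.

Lemma side_cone_mulmx A x :
  center_stabilizer A -> side_cone x -> side_cone (A *m x).
Proof.
move=> A_stab x_cone e e_side; have [_ _ stabV] := center_stabilizer_group.
have [/GammaP[A_lor _ _] _] := A_stab.
rewrite lor_mulmx_invmx //; apply/x_cone/side_normal_mulmx => //.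
exact: stabV.
Qed.

Lemma side_normal_evec k : (k < n)%N -> side_normal (- evec R n k.+1).
Proof.
move=> kn; split; first by rewrite rpredN evec_integral.
- by rewrite !lor_bilinear opprK lor_evec // spatial_evec // eqxx.
- by rewrite lorNl lorC lor_evec // spatial_center.
Qed.

Definition line_normal j k : vec R n :=
  evec R n j.+1 + evec R n k.+1 + evec R n n.+1.

Lemma lor_line_normal x j k : (j < n)%N -> (k < n)%N ->
  lor x (line_normal j k) = spatial j x + spatial k x - time x.
Proof. by move=> jn kn; rewrite !lorDr lor_evec_time !lor_evec. Qed.

Lemma spatial_line_normal i j k : (j < n)%N -> (k < n)%N ->
  spatial i (line_normal j k) = (i == j)%:R + (i == k)%:R.
Proof.
by move=> jn kn; rewrite !spatialD spatial_evec_time addr0 !spatial_evec.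
Qed.

Lemma time_line_normal j k : (j < n)%N -> (k < n)%N ->
  time (line_normal j k) = 1.
Proof. by move=> jn kn; rewrite 2!mxE time_evec_time !time_evec // !add0r. Qed.

Lemma side_normal_line j k : (j < n)%N -> (k < n)%N -> j != k ->
  side_normal (line_normal j k).
Proof.
move=> jn kn /negPf jk; split; first by rewrite !rpredD ?evec_integral.
- rewrite lor_line_normal // !spatial_line_normal // time_line_normal // !eqxx.
  by rewrite (eq_sym k j) jk /=; ring.
- rewrite lorC lor_line_normal // !spatial_center // time_center; ring.
Qed.

Hypothesis n_lt9 : (n < 9)%N.

Lemma side_normal_lor_le0 e f : side_normal e -> side_normal f -> e != f ->
  lor e f <= 0.
Proof.
move=> [e_int ee ec] [f_int ff fc] e_neq_f.
have [cc _] := center_timelike R n_lt9.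
have : 0 < lor (e - f) (e - f).
  apply: (orthogonal_timelike_lor_gt0 cc); last by rewrite subr_eq0.
  by rewrite !lor_bilinear ec fc subrr.
rewrite !lor_bilinear ee ff (lorC f e).
have /intrP[m ->] := lor_int e_int f_int; rewrite lerz0 => lt_m.
have : m%:~R < 1%:~R :> R by lra.
by rewrite ltr_int; lia.
Qed.

Lemma side_normal_evec_or_ge0 e : side_normal e ->
  (exists2 k, (k < n)%N & e = - evec R n k.+1) \/ forall k, 0 <= spatial k e.
Proof.
move=> e_side; have [e_evec|e_evec] :=
  pselect (exists2 k, (k < n)%N & e = - evec R n k.+1); [by left|right=> k].
have [kn|/spatial_ge -> //] := ltnP k n.
rewrite -lor_evec // -oppr_le0 -lorNr.
apply: side_normal_lor_le0 => //; first exact: side_normal_evec.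
by apply/eqP => e_eq; apply: e_evec; exists k.
Qed.

Lemma side_normal_time_ge0 e : side_normal e -> 0 <= time e.
Proof.
move=> e_side; have [[k kn ->]|e_ge0] := side_normal_evec_or_ge0 e_side.
  by rewrite timeN time_evec // oppr0.
have [_ _] := e_side; rewrite lor_center.
have : 0 <= \sum_(i < n) spatial i e by apply: sumr_ge0.
by lra.
Qed.

Lemma side_normal_spatial_le_time e k :
  (1 < n)%N -> side_normal e -> (k < n)%N -> spatial k e <= time e.
Proof.
move=> n_gt1 e_side kn.
have [[j jn ->]|e_ge0] := side_normal_evec_or_ge0 e_side.
  by rewrite spatialN spatial_evec // timeN time_evec // lerN2.
pose j : nat := (k == 0)%N.
have jn : (j < n)%N by rewrite /j; case: (k == 0%N) => //; exact: ltnW.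
have kj : k != j by rewrite /j; case: k {kn j jn}.
have [->|e_neq] := eqVneq e (line_normal k j).
  rewrite spatial_line_normal // time_line_normal // eqxx (negPf kj).
  by rewrite addr0.
have := side_normal_lor_le0 e_side (side_normal_line kn jn kj) e_neq.
by rewrite lor_line_normal //; have := e_ge0 j; lra.
Qed.

Lemma side_normal_finite : finite_set side_normal.
Proof.
have c_timelike := center_timelike R n_lt9.
have n_lt9R : n%:R < 9 :> R by rewrite ltr_nat.
apply: sub_finite_set (finite_image (fun v => v - Pn_center)
  (integral_causal_finite (- 10) c_timelike)) => e [e_int ee ec].
exists (e + Pn_center); last by rewrite addrK.
have sum_c : lor (e + Pn_center) Pn_center = n%:R - 10.
  by rewrite lorDl ec lor_center_center; ring.
split; first by rewrite rpredD ?center_integral.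
- apply: future_causal_lor_lt0 c_timelike _; last by rewrite sum_c; lra.
  by rewrite lorDr sum_c lorC !lorDr ee ec; lra.
- have : 0 <= n%:R :> R by exact: ler0n.
  by rewrite sum_c; lra.
Qed.

End SideNormals.

(* Only here does [n = 8] have to be excluded: the isometry that fixes the
   center [c] and is [-1] on its orthogonal complement is then integral and
   congruent to the identity, and it maps a side normal [e] to [2 c - e]. *)
Lemma side_normal_congruent_eq (R : realType) (n : nat) (e f : vec R n) :
  (n < 8)%N -> side_normal e -> side_normal f -> even (e - f) -> e = f.
Proof.
have defect_gt (q N : R) :
    2 <= q -> N <= 7 -> (-2) ^+ 2 < (4 - 4 * q) * (N - 9).
  by move=> q_ge2 N_le7; nra.
move=> n_lt8 [e_int ee ec] [f_int ff fc] [g g_int ef].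
have [cc _] := center_timelike R (ltnW n_lt8).
have e_eq : e = f + 2 *: g by rewrite -ef addrC subrK.
have [g0|g_neq0] := eqVneq g 0; first by rewrite e_eq g0 scaler0 addr0.
have gc : lor g Pn_center = 0.
  have : lor (e - f) Pn_center = 0 by rewrite !lor_bilinear ec fc subrr.
  by rewrite ef lorZl => /eqP; rewrite mulf_eq0 pnatr_eq0 => /eqP.
have gg_gt0 := orthogonal_timelike_lor_gt0 cc gc g_neq0.
have gg_ge2 : 2 <= lor g g.
  have := center_characteristic g_int; rewrite gc subr0 => /intrP[m half_gg].
  have gg : lor g g = 2 * m%:~R by rewrite -half_gg; field.
  move: gg_gt0; rewrite gg pmulr_rgt0 // ltr0z gtz0_ge1 => m_ge1.
  have : 1 <= m%:~R :> R by rewrite ler1z.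
  lra.
have fg : lor f g = - lor g g.
  by move: ee; rewrite e_eq !lor_bilinear ff (lorC g f); lra.
have sum_sqr : lor (e + f) (e + f) = 4 - 4 * lor g g.
  by rewrite e_eq !lor_bilinear ff (lorC g f) fg; ring.
have sum_center : lor (e + f) Pn_center = -2 by rewrite lorDl ec fc; ring.
have := reverse_cauchy_schwarz (e + f) cc.
rewrite sum_sqr sum_center lor_center_center.
by rewrite leNgt defect_gt // ler_nat.
Qed.

(** * The simplex and its finite reflection group *)

Section Simplex.
Variables (R : realType) (n : nat).
Implicit Types (x e : vec R n) (k : nat).

(* The vertex [vertex 0] is [e_(n+1)]. *)
Definition vertex k : vec R n :=
  spacetime n (fun i => (i < k)%:R) (if k == 0%N then 1 else (minn k 3)%:R).

Definition vertex_coord k x : R :=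
  if k is j.+1 then spatial j x - spatial j.+1 x
  else time x - (spatial 0 x + spatial 1 x + spatial 2 x).

Definition Delta_cone x : Prop := forall k, 0 <= vertex_coord k x.

Lemma sum_spatial_differences x i :
  \sum_(k < n) (spatial k x - spatial k.+1 x) * (i <= k)%:R = spatial i x.
Proof.
under eq_bigr do rewrite mulr_natr mulrb.
rewrite -big_mkcond /=; have [le_in|lt_ni] := leqP i n.
  rewrite (sum_ord_telescope (fun k => spatial k x)) //.
  by rewrite (spatial_ge x (leqnn n)) subr0.
rewrite (spatial_ge x (ltnW lt_ni)) big1 // => k le_ik.
by have := leq_ltn_trans le_ik (ltn_ord k); rewrite ltnNge (ltnW lt_ni).
Qed.

Lemma vertex_decomposition x :
  x = \sum_(k < n.+1) vertex_coord k x *: vertex k.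
Proof.
apply: spacetime_ext => [i lt_in|].
  rewrite raddf_sum big_ord_recl /= spatialZ spatial_spacetime // mulr0 add0r.
  rewrite -[LHS]sum_spatial_differences; apply: eq_bigr => k _.
  by rewrite spatialZ spatial_spacetime.
rewrite summxE big_ord_recl mxE time_spacetime mulr1 /=.
rewrite (eq_bigr (fun k : 'I_n => (spatial k x - spatial k.+1 x) * (0 <= k)%:R +
    (spatial k x - spatial k.+1 x) * (1 <= k)%:R +
    (spatial k x - spatial k.+1 x) * (2 <= k)%:R)) => [|k _]; last first.
  rewrite mxE time_spacetime -!mulrDr -!natrD; congr (_ * _%:R).
  by case: k => -[|[|k]] //= _; rewrite (minn_idPr _).
have /= sum_from0 := sum_spatial_differences x 0.
by rewrite !big_split /= sum_from0 !sum_spatial_differences; ring.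
Qed.

Lemma Delta_coneP x : (1 < n)%N -> Delta x <-> Hn x /\ Delta_cone x.
Proof.
move=> n_gt1; have n_gt0 := ltnW n_gt1.
have last_coord : Defs.coord x n = spatial n.-1 x.
  by rewrite -coord_spatial ?prednK.
have last_ineq : (if (3 <= n)%N
      then Defs.coord x 1 + Defs.coord x 2 + Defs.coord x 3 <= Defs.coord x n.+1
      else Defs.coord x 1 + Defs.coord x 2 <= Defs.coord x n.+1) =
    (0 <= vertex_coord 0 x).
  rewrite subr_ge0 coord_time (coord_spatial x n_gt0) (coord_spatial x n_gt1).
  have [n_gt2|n_le2] := ltnP 2 n; first by rewrite coord_spatial.
  by rewrite (spatial_ge x n_le2) addr0.
rewrite /Delta /= last_ineq last_coord.
split=> [[Hx [sorted [last_ge0 zero_ge0]]]|[Hx x_cone]].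
  split=> // -[|j] //=; rewrite subr_ge0.
  have [lt_jn|le_nj] := ltnP j.+1 n.
    by have := sorted j.+1 lt_jn; rewrite !coord_spatial // ltnW.
  rewrite (spatial_ge x le_nj); have [lt_jn|/spatial_ge -> //] := ltnP j n.
  by have <- : n.-1 = j by lia.
split=> //; split=> [[//|k] /andP[_ lt_kn]|]; last first.
  split; last exact: (x_cone 0%N).
  have := x_cone n; rewrite -{1}(prednK n_gt0) /= prednK //.
  by rewrite (spatial_ge x (leqnn n)) subr0.
rewrite !coord_spatial // ?(ltnW lt_kn) // -subr_ge0; exact: (x_cone k.+1).
Qed.

Lemma lor_vertex k x : (k <= n)%N ->
  lor (vertex k) x = \sum_(i < k) spatial i x - time (vertex k) * time x.
Proof.
move=> le_kn; rewrite lorC lor_spacetime time_spacetime mulrC; congr (_ - _).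
rewrite (big_ord_widen n (fun i => spatial i x)) // [RHS]big_mkcond.
by apply: eq_bigr => i _; rewrite mulr_natr mulrb.
Qed.

Lemma vertex_integral k : vertex k \is a integral.
Proof. by apply: spacetime_integral => //; case: ifP. Qed.

Lemma vertex_causal k : (k <= n)%N -> (n < 9)%N -> future_causal (vertex k).
Proof.
move=> le_kn n_lt9; split; last first.
  by rewrite time_spacetime; case: k {le_kn} => // k; rewrite ltr0n; lia.
rewrite lor_vertex // (eq_bigr (fun=> 1)) => [|i _]; last first.
  by rewrite spatial_spacetime ?ltn_ord // (leq_trans _ le_kn).
rewrite sumr_const card_ord time_spacetime subr_le0.
have [->|k_neq0] := eqVneq k 0%N; first by rewrite mulr1.
by rewrite -natrM ler_nat; nia.
Qed.

Lemma lor_vertex_center_ge k : (k <= n)%N -> -9 <= lor (vertex k) Pn_center.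
Proof.
move=> le_kn; rewrite lor_vertex // time_center (eq_bigr (fun=> 1)) => [|i _].
  rewrite sumr_const card_ord time_spacetime.
  have [->|k_neq0] := eqVneq k 0%N; first by rewrite mulr0n; lra.
  have : (minn k 3)%:R <= 3 :> R by rewrite ler_nat geq_minr.
  have : 0 <= k%:R :> R by exact: ler0n.
  lra.
by rewrite spatial_center // (leq_trans (ltn_ord i)).
Qed.

Lemma vertex_side_cone k : (k <= n)%N -> (1 < n < 9)%N -> side_cone (vertex k).
Proof.
move=> le_kn /andP[n_gt1 n_lt9] e e_side; rewrite lor_vertex // subr_le0.
have lt_kn (i : 'I_k) : (i < n)%N by exact: leq_trans le_kn.
have [[j lt_jn ->]|e_ge0] := side_normal_evec_or_ge0 n_lt9 e_side.
  rewrite timeN time_evec // oppr0 mulr0; apply: sumr_le0 => i _.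
  by rewrite spatialN spatial_evec // oppr_le0.
rewrite time_spacetime; have time_ge0 := side_normal_time_ge0 n_lt9 e_side.
case: k le_kn lt_kn => [|k] le_kn lt_kn; first by rewrite big_ord0 mul1r.
have [le_k3|lt_3k] := leqP k.+1 3.
  apply: le_trans (_ : \sum_(i < k.+1) time e <= _).
    by apply: ler_sum => i _; exact: side_normal_spatial_le_time.
  by rewrite sumr_const card_ord mulr_natl.
have [_ _] := e_side; rewrite lor_center => e_center.
apply: le_trans (_ : \sum_(i < n) spatial i e <= _); last by rewrite /=; lra.
rewrite (big_ord_widen n (fun i => spatial i e)) //.
rewrite [leRHS](bigID (fun i : 'I_n => (i < k.+1)%N)) /= lerDl.
by apply: sumr_ge0.
Qed.

Lemma Delta_cone_side_cone x : (1 < n < 9)%N -> Delta_cone x -> side_cone x.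
Proof.
move=> n_range x_cone e e_side; rewrite (vertex_decomposition x) lor_suml.
apply: sumr_le0 => k _; rewrite lorZl mulr_ge0_le0 //.
by apply: vertex_side_cone => //; rewrite -ltnS.
Qed.

End Simplex.

Section FiniteReflectionGroup.
Variables (R : realType) (n : nat).
Hypotheses (n_gt1 : (1 < n)%N) (n_lt9 : (n < 9)%N).
Implicit Types (x y w : vec R n) (A : mat R n) (k : nat).

Definition simple_root w : Prop :=
  [/\ w \is a integral, lor w w = 2 & lor w Pn_center = 0].

Definition swap_root k : vec R n := evec R n k.+2 - evec R n k.+1.

Lemma lor_swap_root x k : (k.+1 < n)%N ->
  lor x (swap_root k) = spatial k.+1 x - spatial k x.
Proof. by move=> lt_kn; rewrite lorDr lorNr !lor_evec // ltnW. Qed.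

Lemma swap_root_simple k : (k.+1 < n)%N -> simple_root (swap_root k).
Proof.
move=> lt_kn; have k_ltn := ltnW lt_kn; split.
- by rewrite rpredB ?evec_integral.
- rewrite lor_swap_root // !spatialD !spatialN !spatial_evec // !eqxx.
  by rewrite (gtn_eqF (ltnSn k)) (ltn_eqF (ltnSn k)) /=; ring.
- by rewrite lorC lor_swap_root // !spatial_center // subrr.
Qed.

Lemma lor_wvec x : (2 < n)%N ->
  lor x (wvec R n) = spatial 0 x + spatial 1 x + spatial 2 x - time x.
Proof.
by move=> n_gt2; rewrite !lorDr lor_evec_time !lor_evec // ltnW.
Qed.

Lemma wvec_simple : (2 < n)%N -> simple_root (wvec R n).
Proof.
move=> n_gt2; have n_gt0 := ltnW n_gt1; split.
- by rewrite !rpredD ?evec_integral.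
- rewrite lor_wvec // !spatialD !spatial_evec_time !spatial_evec //.
  by rewrite 3!mxE time_evec_time !time_evec //=; ring.
- by rewrite lorC lor_wvec // !spatial_center // time_center; ring.
Qed.

Lemma tperm_mx_refl k : (k.+1 < n)%N ->
  tperm_mx (inord k : 'I_n.+1) (inord k.+1) = refl (swap_root k).
Proof.
move=> lt_kn; have k_ltn := ltnW lt_kn; apply: mulmx_ext => x.
have [_ norm2 _] := swap_root_simple lt_kn.
rewrite mulmx_refl norm2 lor_swap_root // mulrAC mulfV // mul1r -xrowE.
apply/colP => i; rewrite !mxE /= /spatial lt_kn k_ltn -!val_eqE /=.
rewrite !inordK ?leqW //.
case: tpermP => [->|->|/eqP + /eqP]; rewrite ?inordK ?leqW // ?eqxx.
- by rewrite (ltn_eqF (ltnSn k)); ring.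
- by rewrite (gtn_eqF (ltnSn k)); ring.
by rewrite -!val_eqE /= !inordK ?leqW // => /negPf -> /negPf ->; ring.
Qed.

Lemma Sigma_gens_refl A :
  Sigma_gens A -> exists2 w, simple_root w & A = refl w.
Proof.
case=> [[[|k] [// /= lt_kn ->]]|[n_gt2 ->]].
  by exists (swap_root k); [exact: swap_root_simple|rewrite tperm_mx_refl].
by exists (wvec R n) => //; exact: wvec_simple.
Qed.

Lemma Sigma_group : matrix_group (@Sigma R n).
Proof.
apply: gen_group => A /Sigma_gens_refl[w [_ norm2 _] ->].
by apply: refl_unitmx; rewrite norm2.
Qed.

Lemma Sigma_center_stabilizer : @Sigma R n `<=` @center_stabilizer R n.
Proof.
apply: gen_least => [|A /Sigma_gens_refl[w [w_int norm2 w_center] ->]].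
  exact: center_stabilizer_group.
split; last by apply: refl_fixed; rewrite lorC.
by apply: Gamma_refl; rewrite ?norm2 ?divff.
Qed.

(* A point in the interior of the chamber of the finite group, so that every
   simple root is negative on it; [30] only has to be large. *)
Definition chamber_point : vec R n := spacetime n (fun i => (n - i)%:R) 30.

Lemma chamber_point_integral : chamber_point \is a integral.
Proof. exact: spacetime_integral. Qed.

Lemma chamber_point_timelike : future_timelike chamber_point.
Proof.
split; last by rewrite time_spacetime.
rewrite lor_spacetime time_spacetime subr_lt0.
apply: le_lt_trans (_ : _ <= \sum_(i < n) 64%:R) _.
  apply: ler_sum => i _; rewrite spatial_spacetime // -natrM ler_nat.
  by move: n_lt9; nia.
rewrite sumr_const card_ord -mulrnA -natrM ltr_nat.
by move: n_lt9; lia.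
Qed.

Lemma chamber_point_swap_root k :
  (k.+1 < n)%N -> lor chamber_point (swap_root k) < 0.
Proof.
move=> lt_kn; rewrite lor_swap_root // !spatial_spacetime ?(ltnW lt_kn) //.
by rewrite subr_lt0 ltr_nat; lia.
Qed.

Lemma chamber_point_wvec : (2 < n)%N -> lor chamber_point (wvec R n) < 0.
Proof.
move=> n_gt2; rewrite lor_wvec // time_spacetime.
rewrite !spatial_spacetime // ?(ltnW n_gt1) //.
by rewrite -!natrD subr_lt0 ltr_nat; move: n_lt9; lia.
Qed.

Lemma side_cone_Delta_cone x : side_cone x ->
  (forall w, Sigma_gens (refl w) -> simple_root w ->
     lor chamber_point w < 0 -> lor x w <= 0) -> Delta_cone x.
Proof.
move=> x_cone root_le0; have n_gt0 := ltnW n_gt1.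
case=> [|k] /=; rewrite subr_ge0.
  have [n_gt2|n_le2] := ltnP 2 n.
    rewrite -subr_le0 -lor_wvec //; apply: root_le0; first by right.
      exact: wvec_simple.
    exact: chamber_point_wvec.
  rewrite (spatial_ge x n_le2) addr0 -subr_le0 -lor_line_normal //.
  by apply: x_cone; exact: side_normal_line.
have [lt_kn|le_nk] := ltnP k.+1 n.
  rewrite -subr_le0 -lor_swap_root //; apply: root_le0.
  - by left; exists k.+1; rewrite /= lt_kn tperm_mx_refl.
  - exact: swap_root_simple.
  - exact: chamber_point_swap_root.
rewrite (spatial_ge x le_nk); have [lt_kn|/spatial_ge -> //] := ltnP k n.
by rewrite -lor_evec // -oppr_le0 -lorNr; apply/x_cone/side_normal_evec.
Qed.

Lemma Sigma_fold y : future_timelike y -> side_cone y ->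
  exists2 A, Sigma A & Delta_cone (A *m y).
Proof.
move=> y_timelike y_cone; have [Sigma1 SigmaM _] := Sigma_group.
have [|||A SA A_max] := @Gamma_orbit_argmax R n (@Sigma R n) chamber_point y
    _ _ chamber_point_integral _ y_timelike.
- by move=> A /Sigma_center_stabilizer[].
- by exists 1.
- exact/timelike_causal/chamber_point_timelike.
exists A => //; apply: side_cone_Delta_cone.
  by apply: side_cone_mulmx => //; exact: Sigma_center_stabilizer.
move=> w gen_w [_ norm2 _] w_neg; apply: lor_refl_le_lor_le0 w_neg _.
  by rewrite norm2.
by rewrite mulmxA; apply: A_max; apply: SigmaM => //; exact: gen_base.
Qed.

Lemma PnP x : Pn x <-> Hn x /\ side_cone x.
Proof.
have n_range : (1 < n < 9)%N by rewrite n_gt1.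
have Hn_mulmx A y : Sigma A -> Hn y -> Hn (A *m y).
  move=> /Sigma_center_stabilizer[/GammaP[A_lor A_pos _] _] [yy y_future].
  by split; [rewrite A_lor|apply: A_pos; rewrite ?yy ?ltrN10].
split=> [[A [SA [y [/(Delta_coneP _ n_gt1)[Hy y_cone] ->]]]]|[Hx x_cone]].
  split; first exact: Hn_mulmx.
  apply: side_cone_mulmx; first exact: Sigma_center_stabilizer.
  exact: Delta_cone_side_cone.
have [A SA Ax_cone] := Sigma_fold (Hn_timelike Hx) x_cone.
have [_ _ SigmaV] := Sigma_group.
exists (invmx A); split; first exact: SigmaV.
exists (A *m x); rewrite mulKmx; last first.
  by have [/Gamma_unitmx] := Sigma_center_stabilizer SA.
by split=> //; apply/(Delta_coneP _ n_gt1); split=> //; exact: Hn_mulmx.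
Qed.

End FiniteReflectionGroup.

(** * Descent towards the center *)

Section CenterOrbit.
Variables (R : realType) (n : nat).
Hypotheses (n_gt1 : (1 < n)%N) (n_lt9 : (n < 9)%N).
Implicit Types (x v z e : vec R n) (A : mat R n).

(* By [center_like_descent], these are exactly the points of the [Gamma2]-orbit
   of the center. *)
Definition center_like v : Prop :=
  [/\ even (v - Pn_center), lor v v = lor (Pn_center : vec R n) Pn_center
    & 0 < time v].

Lemma center_like_timelike v : center_like v -> future_timelike v.
Proof.
case=> _ vv v_future; split=> //.
by rewrite vv; case: (center_timelike R n_lt9).
Qed.

Lemma center_like_integral v : center_like v -> v \is a integral.
Proof.
case=> -[u u_int /eqP]; rewrite subr_eq => /eqP -> _ _.
by rewrite scaler_nat rpredD ?rpredMn ?center_integral.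
Qed.

Lemma center_like_mulmx A v : Gamma2 A -> center_like v -> center_like (A *m v).
Proof.
move=> A_Gamma2 v_like; have [v_even vv v_future] := v_like.
have /Gamma2P[/GammaP[A_lor A_pos A_int] _] := A_Gamma2.
have [_ Av_future] :=
  future_timelike_mulmx A_lor A_pos (center_like_timelike v_like).
split=> //; last by rewrite A_lor.
have -> : A *m v - Pn_center = (A *m v - v) + (v - Pn_center).
  by rewrite addrA subrK.
by apply: evenD => //; apply: Gamma2_even => //; exact: center_like_integral.
Qed.

Lemma center_like_center : center_like Pn_center.
Proof.
split=> //; last by rewrite time_center.
by rewrite subrr; exists 0; rewrite ?rpred0 ?scaler0.
Qed.

Definition odd_int (a : R) : Prop := exists m : int, a = (2 * m + 1)%:~R.

Lemma center_like_spatial_odd v k :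
  center_like v -> (k < n)%N -> odd_int (spatial k v).
Proof.
case=> -[u u_int v_even] _ _ lt_kn; have /intrP[m u_k] := spatial_int k u_int.
exists m; have := congr1 (spatial k) v_even.
rewrite spatialD spatialN spatial_center // spatialZ u_k.
by rewrite intrD intrM => /eqP; rewrite subr_eq => /eqP.
Qed.

Lemma center_like_time_odd v : center_like v -> odd_int (time v).
Proof.
case=> -[u u_int v_even] _ _; have /intrP[m u_time] := time_int u_int.
exists (m + 1); have := congr1 (fun x : vec R n => time x) v_even.
rewrite mxE timeN time_center mxE u_time !(intrD, intrM); lra.
Qed.

Lemma odd_int_ge1 (a : R) : odd_int a -> 0 <= a -> 1 <= a.
Proof. by move=> [m ->]; rewrite ler0z ler1z; lia. Qed.

Lemma odd_int_sum_le (a b t : R) : odd_int a -> odd_int b -> odd_int t ->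
  a + b <= t -> a + b + 1 <= t.
Proof.
by move=> [p ->] [q ->] [r ->]; rewrite -[1]/(1%:~R) -!intrD !ler_int; lia.
Qed.

Lemma Delta_cone_sorted x i j : Delta_cone x -> (i <= j)%N ->
  spatial j x <= spatial i x.
Proof.
move=> x_cone; elim: j => [|j IHj]; first by rewrite leqn0 => /eqP ->.
rewrite leq_eqVlt => /orP[/eqP -> //|/IHj]; apply: le_trans.
by rewrite -subr_ge0; exact: (x_cone j.+1).
Qed.

Lemma center_like_spatial_ge1 z k :
  center_like z -> Delta_cone z -> (k < n)%N -> 1 <= spatial k z.
Proof.
move=> z_like z_cone lt_kn; apply: odd_int_ge1.
  exact: center_like_spatial_odd.
by rewrite -(spatial_ge z (leqnn n)); exact: Delta_cone_sorted (ltnW lt_kn).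
Qed.

(* For [n = 2] there is no third coordinate, and parity provides the [1]. *)
Lemma center_like_third_entry z : center_like z -> Delta_cone z ->
  exists c, [/\ 1 <= c, c <= spatial 1 z,
    spatial 0 z + spatial 1 z + c <= time z
    & forall i, (2 <= i < n)%N -> spatial i z <= c].
Proof.
move=> z_like z_cone; have n_gt0 := ltnW n_gt1.
have := z_cone 0%N; rewrite subr_ge0 => sum_le.
have [n_gt2|n_le2] := ltnP 2 n.
  exists (spatial 2 z); split=> //; first exact: center_like_spatial_ge1.
    exact: Delta_cone_sorted.
  by move=> i /andP[i_ge2 _]; exact: Delta_cone_sorted.
exists 1; split=> //; first exact: center_like_spatial_ge1.
  apply: odd_int_sum_le; try exact: center_like_spatial_odd.
    exact: center_like_time_odd.
  by rewrite (spatial_ge z n_le2) addr0 in sum_le.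
by move=> i /andP[i_ge2]; rewrite ltnNge (leq_trans n_le2).
Qed.

Lemma center_like_Delta z : center_like z -> Delta_cone z -> z = Pn_center.
Proof.
move=> z_like z_cone; have [_ zz z_future] := z_like.
have [c [c_ge1 le_c sum_le le_c_tail]] := center_like_third_entry z_like z_cone.
have zz_expand : time z ^+ 2 = \sum_(i < n) spatial i z ^+ 2 + (9 - n%:R).
  by move: zz; rewrite lor_center_center lor_sqr sqr_spatial_norm; lra.
have spatial0 : spatial 0 z = 1.
  apply: (sqr_sum_le_eq1 (N := n%:R) _ c_ge1 le_c _ sum_le).
  - by rewrite ltr_nat.
  - exact: Delta_cone_sorted.
  rewrite zz_expand lerD2r.
  apply: (sum_ord_le_first_two (f := fun i => spatial i z ^+ 2)) => // i.
  move=> i_range; have /andP[_ lt_in] := i_range.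
  have entry_ge1 := center_like_spatial_ge1 z_like z_cone lt_in.
  by rewrite ler_sqr ?nnegrE ?le_c_tail //; lra.
have spatial_eq1 k : (k < n)%N -> spatial k z = 1.
  move=> lt_kn; apply: le_anti; rewrite center_like_spatial_ge1 // andbT.
  by rewrite -spatial0; exact: Delta_cone_sorted.
apply: spacetime_ext => [k lt_kn|].
  by rewrite spatial_center ?spatial_eq1.
rewrite time_center; apply/eqP; rewrite -(eqrXn2 (n := 2)) ?(ltW z_future) //.
rewrite zz_expand (eq_bigr (fun=> 1)) => [|i _]; last first.
  by rewrite spatial_eq1 ?expr1n.
by rewrite sumr_const card_ord; apply/eqP; ring.
Qed.

Lemma center_like_side_cone v : center_like v -> side_cone v -> v = Pn_center.
Proof.
move=> v_like v_cone; have v_timelike := center_like_timelike v_like.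
have [A SA Av_cone] := Sigma_fold n_gt1 n_lt9 v_timelike v_cone.
have [A_Gamma Ac] := Sigma_center_stabilizer n_gt1 SA.
have /GammaP[A_lor A_pos A_int] := A_Gamma.
apply: (can_inj (mulKmx (Gamma_unitmx A_Gamma))); rewrite Ac.
have [_ Av_future] := future_timelike_mulmx A_lor A_pos v_timelike.
have [v_even vv _] := v_like; apply: center_like_Delta Av_cone; split=> //.
  by rewrite -Ac -mulmxBr; exact: even_mulmxl.
by rewrite A_lor.
Qed.

Lemma Gamma2_refl_side e : side_normal e -> Gamma2 (refl e).
Proof. by move=> [e_int ee _]; exact: Gamma2_refl. Qed.

(* A vector outside of the cone is moved closer to the center by the reflection
   in some side, and there is no infinite descent. *)
Lemma center_like_descent (P : vec R n -> Prop) : P Pn_center ->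
  (forall v e, center_like v -> side_normal e -> 0 < lor v e ->
     P (refl e *m v) -> P v) ->
  forall v, center_like v -> P v.
Proof.
move=> P_center P_step v v_like; apply: contrapT => not_Pv.
have [||u [u_like not_Pu] u_max] := integral_causal_argmax
    (center_timelike R n_lt9) (T := [set u | center_like u /\ ~ P u]).
- move=> u [u_like _]; split; first exact: center_like_integral.
  exact/timelike_causal/center_like_timelike.
- by exists v.
have [u_cone|] := pselect (side_cone u).
  by rewrite (center_like_side_cone u_like u_cone) in not_Pu.
move=> /existsNP[e /not_implyP[e_side /negP]]; rewrite -ltNge => ue_gt0.
have [_ ee ec] := e_side.
apply/not_Pu/(P_step u e) => //; apply: contrapT => not_P.
suff /u_max : center_like (refl e *m u) /\ ~ P (refl e *m u).
  rewrite leNgt lor_refl_gt ?ee // (lorC Pn_center) ec.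
  by rewrite mulrN1 oppr_lt0 ue_gt0.
by split=> //; apply: center_like_mulmx => //; exact: Gamma2_refl_side.
Qed.

(* So [Pn] is the Dirichlet domain of the center. *)
Lemma center_like_far x v : (forall e, side_normal e -> lor x e < 0) ->
  center_like v -> v != Pn_center -> lor x v < lor x Pn_center.
Proof.
move=> x_neg; move: v; apply: center_like_descent; first by rewrite eqxx.
move=> v e v_like e_side ve IHv _.
have [_ ee _] := e_side.
have closer : lor v x < lor (refl e *m v) x.
  by rewrite lor_refl_gt ?ee // pmulr_rlt0 // x_neg.
rewrite lorC; apply: lt_le_trans closer _; rewrite lorC.
by have [->|/IHv/ltW] := eqVneq (refl e *m v) Pn_center.
Qed.

End CenterOrbit.

(** * The polytope *)

Lemma hull_sum (R : realType) (n : nat) (V : seq (vec R n)) (x : vec R n)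
    (I : finType) (c : I -> R) (u : I -> vec R n) :
  Hn x -> (forall i, 0 <= c i) -> (forall i, u i \in V) ->
  x = \sum_i c i *: u i -> hull V x.
Proof.
move=> Hx c_ge0 uV x_sum; split=> //.
have index_lt i : (index (u i) V < size V)%N by rewrite index_mem.
exists (fun j => \sum_(i | Ordinal (index_lt i) == j) c i); split.
  by move=> j; apply: sumr_ge0.
rewrite x_sum (partition_big (fun i => Ordinal (index_lt i)) xpredT) //=.
apply: eq_bigr => j _; rewrite scaler_suml; apply: eq_bigr => i /eqP <-.
by rewrite /= nth_index.
Qed.

Section Polytope.
Variables (R : realType) (n : nat).
Hypotheses (n_gt1 : (1 < n)%N) (n_lt9 : (n < 9)%N).
Implicit Types (x y v e : vec R n) (A : mat R n) (E : seq (vec R n)).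

Definition Pn_vertices : set (vec R n) :=
  [set v | exists2 A, Sigma A & exists2 k, (k <= n)%N & v = A *m vertex R n k].

Lemma Pn_vertices_spec v : Pn_vertices v ->
  [/\ v \is a integral, future_causal v, -9 <= lor v Pn_center & side_cone v].
Proof.
move=> [A SA [k le_kn ->]]; have n_range : (1 < n < 9)%N by rewrite n_gt1.
have A_stab := Sigma_center_stabilizer n_gt1 SA.
have [/GammaP[A_lor A_pos A_int] Ac] := A_stab.
split; first by rewrite mxOverM ?vertex_integral.
- by apply: future_causal_mulmx => //; exact: vertex_causal.
- by rewrite -Ac A_lor lor_vertex_center_ge.
- by apply: side_cone_mulmx => //; exact: vertex_side_cone.
Qed.

Lemma Pn_vertices_finite : finite_set Pn_vertices.
Proof.
apply: sub_finite_set
  (integral_causal_finite (-9) (center_timelike R n_lt9)) => v.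
by move=> /Pn_vertices_spec[].
Qed.

Lemma Pn_hull : exists V : seq (vec R n),
  (forall v, v \in V -> lor v v <= 0 /\ 0 < v ord_max 0) /\ @Pn R n = hull V.
Proof.
have /finite_seqP[V vertices_V] := Pn_vertices_finite; exists V.
have V_spec v : v \in V -> Pn_vertices v by rewrite vertices_V.
split; first by move=> v /V_spec/Pn_vertices_spec[].
apply/seteqP; split=> [_ [A [SA [x [Delta_x ->]]]]|x [Hx [c [c_ge0 x_sum]]]].
  have [_ x_cone] := (Delta_coneP x n_gt1).1 Delta_x.
  have [HAx _] : Hn (A *m x) /\ side_cone (A *m x).
    by apply/(PnP n_gt1 n_lt9); exists A; split=> //; exists x.
  apply: (hull_sum (c := fun k : 'I_n.+1 => vertex_coord k x)
    (u := fun k => A *m vertex R n k)) => // [k|].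
    suff : [set` V] (A *m vertex R n k) by [].
    by rewrite -vertices_V; exists A => //; exists k => //; rewrite -ltnS.
  rewrite {1}(vertex_decomposition x) mulmx_sumr; apply: eq_bigr => k _.
  by rewrite scalemxAr.
apply/(PnP n_gt1 n_lt9); split=> // e e_side; rewrite x_sum lor_suml.
apply: sumr_le0 => i _; rewrite lorZl mulr_ge0_le0 //.
by have /V_spec/Pn_vertices_spec[_ _ _] := mem_nth 0 (ltn_ord i); apply.
Qed.

Lemma Pn_center_interior :
  exists x, Hn x /\ forall e, side_normal e -> lor x e < 0.
Proof.
have c_timelike := center_timelike R n_lt9; have [cc _] := c_timelike.
exists (normalize Pn_center); split=> [|e [_ _ ec]]; first exact: normalize_Hn.
by rewrite lor_normalize_lt0 // lorC ec ltrN10.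
Qed.

(* The point is the orthogonal projection of the center to the side. *)
Lemma Pn_side_interior e : side_normal e ->
  exists x, Pn x /\ lor x e = 0 /\
    forall f, side_normal f -> f != e -> lor x f < 0.
Proof.
move=> e_side; have [_ ee ec] := e_side; pose p := Pn_center + e.
have p_timelike : future_timelike p.
  have pp : lor p p = n%:R - 10.
    by rewrite !lor_bilinear lor_center_center (lorC _ e) ec ee; ring.
  split; first by rewrite pp subr_lt0 ltr_nat ltnW.
  rewrite mxE time_center; have := side_normal_time_ge0 n_lt9 e_side; lra.
have [pp _] := p_timelike.
have pe : lor p e = 0 by rewrite lorDl lorC ec ee addNr.
have pf_lt0 f : side_normal f -> f != e -> lor p f < 0.
  move=> f_side f_neq_e; have [_ _ fc] := f_side.
  have := side_normal_lor_le0 n_lt9 f_side e_side f_neq_e.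
  by rewrite lorDl (lorC Pn_center) fc (lorC e); lra.
exists (normalize p); split; last first.
  split; first exact: lor_normalize_eq0.
  by move=> f f_side f_neq_e; rewrite lor_normalize_lt0 //; exact: pf_lt0.
apply/(PnP n_gt1 n_lt9); split=> [|f f_side]; first exact: normalize_Hn.
rewrite lor_normalize_le0 //.
have [->|f_neq_e] := eqVneq f e; first by rewrite pe.
exact/ltW/pf_lt0.
Qed.

Lemma Pn_polytope E :
  @side_normal R n = [set` E] -> polytope_with_sides (@Pn R n) E.
Proof.
move=> sideE; have E_side e : e \in E <-> side_normal e by rewrite sideE.
split.
- by move=> e /E_side[].
- apply/seteqP; split=> x.
    move=> /(PnP n_gt1 n_lt9)[Hx x_cone].
    by split=> // e /E_side; exact: x_cone.
  move=> [Hx x_cone]; apply/(PnP n_gt1 n_lt9).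
  by split=> // e /E_side; exact: x_cone.
- have [x [Hx x_neg]] := Pn_center_interior.
  by exists x; split=> // e /E_side; exact: x_neg.
- move=> e /E_side/Pn_side_interior[x [Px [xe x_neg]]].
  by exists x; split=> //; split=> // f /E_side; exact: x_neg.
- exact: Pn_hull.
Qed.

(* If [lor e f <= -2], then [e + f] is time-like, and no causal vector can be
   orthogonal to it. *)
Lemma side_normals_adjacent_lor E e f :
  side_normal e -> side_normal f -> e != f -> Defs.adjacent E e f ->
  lor e f = -1 \/ lor e f = 0.
Proof.
move=> e_side f_side e_neq_f [p [pp [p_future [_ [pe [pf _]]]]]].
have [e_int ee _] := e_side; have [f_int ff _] := f_side.
have : lor e f <= 0 by exact: side_normal_lor_le0.
have : -1 <= lor e f.
  rewrite leNgt; apply/negP => ef_lt.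
  have sum_timelike : lor (e + f) (e + f) < 0.
    by rewrite !lor_bilinear ee ff (lorC f e); lra.
  have p_neq0 : p != 0 by apply: contraTneq p_future => ->; rewrite mxE ltxx.
  have := orthogonal_timelike_lor_gt0 sum_timelike _ p_neq0.
  by rewrite lorDr pe pf addr0 ltNge pp => /(_ erefl).
have /intrP[m ->] := lor_int e_int f_int.
rewrite -[-1]/((-1)%:~R) ler_int lerz0 => m_ge m_le.
have [->|->] : m = -1 \/ m = 0 by lia.
  by left.
by right.
Qed.

Lemma side_normals_right_angled E :
  @side_normal R n = [set` E] -> right_angled E.
Proof.
move=> sideE; have E_side g : g \in E -> side_normal g by rewrite sideE.
move=> e f /E_side e_side /E_side f_side e_neq_f; rewrite /dihedral_angle.
case/(side_normals_adjacent_lor e_side f_side e_neq_f) => ->.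
  by left; rewrite opprK acos1.
by right; rewrite oppr0 acos0.
Qed.

Lemma Gamma2_Pn_cover y : Hn y ->
  exists A, Gamma2 A /\ exists x, Pn x /\ y = A *m x.
Proof.
move=> Hy; have y_timelike := Hn_timelike Hy.
have [Gamma2_1 Gamma2M Gamma2V] := Gamma2_group R n.
have [|||A A_Gamma2 A_max] := @Gamma_orbit_argmax R n (@Gamma2 R n) Pn_center y
    _ _ (center_integral R n) _ y_timelike.
- by move=> A [].
- by exists 1.
- exact/timelike_causal/center_timelike.
have /Gamma2P[A_Gamma _] := A_Gamma2; have /GammaP[A_lor A_pos _] := A_Gamma.
exists (invmx A); split; first exact: Gamma2V.
exists (A *m y); rewrite mulKmx ?Gamma_unitmx //; split=> //.
apply/(PnP n_gt1 n_lt9); split=> [|e e_side].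
  have [_ Ay_future] := future_timelike_mulmx A_lor A_pos y_timelike.
  by have [yy _] := Hy; split; rewrite ?A_lor.
have [_ ee ec] := e_side.
apply: (lor_refl_le_lor_le0 (w := e) (u := Pn_center)).
- by rewrite ee.
- by rewrite lorC ec ltrN10.
- by rewrite mulmxA; apply/A_max/Gamma2M => //; exact: Gamma2_refl_side.
Qed.

End Polytope.

Section CongruenceGroup.
Variables (R : realType) (n : nat).
Hypotheses (n_gt1 : (1 < n)%N) (n_lt8 : (n < 8)%N).
Implicit Types (x y v e : vec R n) (A : mat R n).

Let n_lt9 : (n < 9)%N := ltnW n_lt8.

Lemma Gamma2_fix_center A : Gamma2 A -> A *m Pn_center = Pn_center -> A = 1.
Proof.
move=> A_Gamma2 Ac; have /Gamma2P[A_Gamma _] := A_Gamma2.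
have /GammaP[A_lor _ _] := A_Gamma.
have A_evec k : (k < n)%N -> A *m evec R n k.+1 = evec R n k.+1.
  move=> lt_kn; have evec_side := @side_normal_evec R n k lt_kn.
  apply: oppr_inj; rewrite -mulmxN.
  apply: (side_normal_congruent_eq n_lt8) => //.
    exact: side_normal_mulmx.
  by apply: Gamma2_even => //; case: evec_side.
apply: mulmx_ext => x; rewrite mul1mx.
have spatial_fixed k : (k < n)%N -> spatial k (A *m x) = spatial k x.
  by move=> lt_kn; rewrite -!lor_evec // -{1}(A_evec k lt_kn) A_lor.
apply: spacetime_ext => //.
have : lor (A *m x) Pn_center = lor x Pn_center by rewrite -{1}Ac A_lor.
rewrite !lor_center (eq_bigr (fun i : 'I_n => spatial i x)) => [|i _].
  by move/addrI/oppr_inj/mulfI; apply.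
exact: spatial_fixed.
Qed.

Lemma Gamma2_moves_center A :
  Gamma2 A -> A != 1 -> A *m Pn_center != Pn_center.
Proof.
by move=> A_Gamma2; apply: contra => /eqP/(Gamma2_fix_center A_Gamma2) ->.
Qed.

Lemma Gamma2_gen : @Gamma2 R n = gen [set refl e | e in @side_normal R n].
Proof.
have [_ Gamma2M _] := Gamma2_group R n.
apply/seteqP; split; last first.
  apply: gen_least => [|_ [e e_side <-]]; first exact: Gamma2_group.
  exact: Gamma2_refl_side.
suff gen_orbit v : center_like v -> forall A, Gamma2 A -> A *m Pn_center = v ->
    gen [set refl e | e in @side_normal R n] A.
  move=> A A_Gamma2; apply: (gen_orbit (A *m Pn_center)) => //.
  by apply: center_like_mulmx => //; exact: center_like_center.
move: v; apply: (center_like_descent n_gt1 n_lt9) => [A A_Gamma2 Ac|].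
  by rewrite (Gamma2_fix_center A_Gamma2 Ac); exact: gen1.
move=> v e v_like e_side _ gen_closer A A_Gamma2 Ac.
have [_ ee _] := e_side.
have -> : A = refl e * (refl e * A).
  by rewrite mulrA refl_involutive ?mul1r // ee oner_neq0.
apply: genM; first by apply: gen_base; exists e.
apply: gen_closer; last by rewrite -mulmxA Ac.
by apply: Gamma2M => //; exact: Gamma2_refl_side.
Qed.

Lemma Pn_interior_lor_lt0 x e :
  interiorH (@Pn R n) x -> side_normal e -> lor x e < 0.
Proof.
move=> x_int e_side; have [_ ee _] := e_side.
by apply: (interiorH_lor_lt0 x_int) => // y /(PnP n_gt1 n_lt9)[_]; apply.
Qed.

(* If [x] and [A x] were both interior, then each would be strictly closer to
   the center than the other. *)
Lemma Pn_interior_disjoint A x : Gamma2 A -> A != 1 ->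
  interiorH (@Pn R n) x -> ~ interiorH (@Pn R n) (A *m x).
Proof.
move=> A_Gamma2 A_neq1 x_int Ax_int; have [_ _ Gamma2V] := Gamma2_group R n.
have /Gamma2P[/GammaP[A_lor _ _] _] := A_Gamma2.
have AV_neq1 : invmx A != 1.
  by apply: contra A_neq1 => /eqP AV1; rewrite -[A]invmxK AV1 invmx1.
have far B y : Gamma2 B -> B != 1 -> interiorH (@Pn R n) y ->
    lor y (B *m Pn_center) < lor y Pn_center.
  move=> B_Gamma2 B_neq1 y_int; apply: center_like_far => //.
  - by move=> e; exact: Pn_interior_lor_lt0.
  - by apply: center_like_mulmx => //; exact: center_like_center.
  - exact: Gamma2_moves_center.
have Ax_closer := far _ x (Gamma2V _ A_Gamma2) AV_neq1 x_int.
rewrite -lor_mulmx_invmx // in Ax_closer.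
have := far _ _ A_Gamma2 A_neq1 Ax_int.
by rewrite A_lor => /(lt_trans Ax_closer); rewrite ltxx.
Qed.

Lemma Pn_fundamental : fundamental_polytope (@Gamma2 R n) (@Pn R n).
Proof.
split=> [A A_Gamma2 A_neq1 x|]; first exact: Pn_interior_disjoint.
exact: Gamma2_Pn_cover.
Qed.

End CongruenceGroup.

Theorem theorem2p1 (R : realType) (n : nat) :
  (2 <= n <= 7)%N ->
  exists E : seq (vec R n),
    [/\ polytope_with_sides (@Pn R n) E,
        right_angled E,
        fundamental_polytope (@Gamma2 R n) (@Pn R n)
      & @Gamma2 R n = gen [set refl e | e in [set e | e \in E]]].
Proof.
move=> /andP[n_gt1 n_lt8]; have n_lt9 : (n < 9)%N := leqW n_lt8.
have /finite_seqP[E sideE] := side_normal_finite R n_lt9.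
exists E; split.
- exact: Pn_polytope.
- exact: side_normals_right_angled.
- exact: Pn_fundamental.
- by rewrite Gamma2_gen // sideE.
Qed.
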